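(* Let $A \in \mathbb{C}^{n\times p}$, $B \in \mathbb{C}^{m\times q}$, $C \in \mathbb{C}^{n\times q}$ be given and let $\phi(X) = (AXB + C)(AXB + C)^{*} - I_n$ for $X \in \mathbb{C}^{p\times m}$. Define $$N_1 = \begin{bmatrix} CC^{*} - I_n & A \\ A^{*} & 0\end{bmatrix},\ N_2 = \begin{bmatrix} CC^{*} - I_n & CB^{*} & A \\ A^{*} & 0 & 0\end{bmatrix},\ N_3 = \begin{bmatrix} CC^{*} - I_n & CB^{*} \\ BC^{*} & BB^{*}\end{bmatrix},\ N_4 = \begin{bmatrix} CC^{*} - I_n & CB^{*} & A \\ BC^{*} & BB^{*} & 0\end{bmatrix},$$ and $s_1 = r(N_1) - 2r(N_2)$, $s_2 = r(N_3) - 2r(N_4)$, $s_3 = i_{+}(N_1) + i_{-}(N_3) - r(N_2) - r(N_4)$, $s_4 = i_{-}(N_1) + i_{+}(N_3) - r(N_2) - r(N_4)$. Then \begin{align*} \max_{X} r[\phi(X)] &= \min\{ r[\,CC^{*} - I_n,\, CB^{*},\, A\,],\ r(N_1),\ r(N_3)\},\\ \min_{X} r[\phi(X)] &= 2r[\,CC^{*} - I_n,\, CB^{*},\, A\,] + \max\{s_1, s_2, s_3, s_4\},\\ \max_{X} i_{\pm}[\phi(X)] &= \min\{ i_{\pm}(N_1),\ i_{\pm}(N_3)\},\\ \min_{X} i_{\pm}[\phi(X)] &= r[\,CC^{*} - I_n,\, CB^{*},\, A\,] + \max\{ i_{\pm}(N_1) - r(N_2),\ i_{\pm}(N_3) -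 r(N_4)\}, \end{align*} where all extrema are over $X \in \mathbb{C}^{p\times m}$.
   Context: $r$ is rank; $i_{\pm}(H)$ are the numbers of positive/negative eigenvalues of a Hermitian matrix $H$; $[\,U,V,W\,]$ is a row block matrix. *)

(* Defs.v *)
From HB Require Import structures.
From mathcomp Require Import all_boot all_order all_algebra.
Set Implicit Arguments. Unset Strict Implicit. Unset Printing Implicit Defensive.
Import Order.TTheory GRing.Theory Num.Theory.
Local Open Scope ring_scope.

Definition ctmx (C : numClosedFieldType) (m n : nat) (A : 'M[C]_(m, n)) : 'M[C]_(n, m) :=
  (map_mx Num.conj A)^T.

(* eigenvalues of a square matrix, listed with algebraic multiplicity:
   a sequence s with char_poly H = lead_coef * \prod_(z <- s) ('X - z) *)
Definition eigvals (C : numClosedFieldType) (n : nat) (H : 'M[C]_n) : seq C :=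
  sval (closed_field_poly_normal (char_poly H)).

Definition ipos (C : numClosedFieldType) (n : nat) (H : 'M[C]_n) : nat :=
  count (fun z => 0 < z) (eigvals H).
Definition ineg (C : numClosedFieldType) (n : nat) (H : 'M[C]_n) : nat :=
  count (fun z => z < 0) (eigvals H).

Definition is_max_of (T : Type) (f : T -> int) (v : int) : Prop :=
  (exists X, f X = v) /\ (forall X, f X <= v).
Definition is_min_of (T : Type) (f : T -> int) (v : int) : Prop :=
  (exists X, f X = v) /\ (forall X, v <= f X).

(* Main.v *)
Require Import Defs.
From HB Require Import structures.
From mathcomp Require Import all_boot all_order all_algebra.
From mathcomp Require Import zify.
Import Order.TTheory GRing.Theory Num.Theory.
Local Open Scope ring_scope.
Set Implicit Arguments. Unset Strict Implicit. Unset Printing Implicit Defensive.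

(* phi(X) is the Schur complement of -I in the Hermitian matrix
   L(X) = H + E X F^* + (E X F^* )^*  with H = [-I, C^*; C, -I], E = [0; A],
   F = [B^*; 0], so inertias and ranks only shift, and it suffices to treat L(X).
   View H as a form; let K1 = ker E, K2 = ker F (row kernels), K0 = their
   intersection.  A vector of K0 outside the radical of H spans, alone or with a
   partner, a nondegenerate piece of L(X) not depending on X; passing to its
   orthogonal shifts all the quantities involved by the same constants.  Once K0
   lies in the radical, choose a basis adapted to K0, K1, K2: L(X) is then an
   arbitrary Hermitian completion of [D1, ?, ?; ?, D2, ?; ?, ?, ?] with
   D1 = H|K1 and D2 = H|K2, and the extremal completions are written down. *)

(** The four numbers s_1, ..., s_4 come from a single completion that minimizes i_+ and i_- at once:
    the minimal rank is then the sum of the two minimal inertias, each a maximum of two terms, and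
    expanding that sum of maxima gives the four cases. The maxima of i_+ and i_- need not be
    attained together, so the maximal rank needs a completion of its own. Only vectors of K0 may be
    split off, because neither E X F^h nor its conjugate transpose sees them; the removed piece then
    contributes the same pair (k_+, k_-) for every X. Every rank shifts by k_+ + k_- and every i_+
    or i_- by k_+ or k_-, and all the inequalities to be proved are invariant under such shifts. The
    passage to the Schur complement is a shift of the same kind, by (0, q). In the terminal case let
    a, b, c be the dimensions of K1/K0, K2/K0 and of a complement of K1 + K2. The rank terms become
    r0 = a+b+c, r2 = r0+b+c, r4 = r0+a+c, and the two bordered inertias are i(D1)+b+c and i(D2)+a+c.
    The lower bounds thus reduce to i(D1) and i(D2), the inertias of compressions of L(X). *)

Local Notation "A ^h" := (ctmx A) (at level 8, format "A ^h").

(** * Conjugate transposes *)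

Section ConjugateTranspose.
Variable C : numClosedFieldType.
Implicit Types m n p : nat.

Lemma ctmxK m n (A : 'M[C]_(m, n)) : A^h^h = A.
Proof. by rewrite /ctmx map_trmx trmxK -map_mx_comp (map_mx_id (@conjCK _)). Qed.

Lemma ctmxM m n p (A : 'M[C]_(m, n)) (B : 'M[C]_(n, p)) :
  (A *m B)^h = B^h *m A^h.
Proof. by rewrite /ctmx map_mxM trmx_mul. Qed.

Lemma ctmxD m n (A B : 'M[C]_(m, n)) : (A + B)^h = A^h + B^h.
Proof. by rewrite /ctmx map_mxD linearD. Qed.

Lemma ctmxN m n (A : 'M[C]_(m, n)) : (- A)^h = - A^h.
Proof. by rewrite /ctmx map_mxN linearN. Qed.

Lemma ctmxB m n (A B : 'M[C]_(m, n)) : (A - B)^h = A^h - B^h.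
Proof. by rewrite ctmxD ctmxN. Qed.

Lemma ctmxZ m n a (A : 'M[C]_(m, n)) : (a *: A)^h = a^* *: A^h.
Proof. by rewrite /ctmx map_mxZ linearZ. Qed.

Lemma ctmx0 m n : (0 : 'M[C]_(m, n))^h = 0.
Proof. by rewrite /ctmx map_mx0 trmx0. Qed.

Lemma ctmx1 n : (1%:M : 'M[C]_n)^h = 1%:M.
Proof. by rewrite /ctmx map_mx1 trmx1. Qed.

Lemma ctmx_row m n1 n2 (A : 'M[C]_(m, n1)) (B : 'M[C]_(m, n2)) :
  (row_mx A B)^h = col_mx A^h B^h.
Proof. by rewrite /ctmx map_row_mx tr_row_mx. Qed.

Lemma ctmx_col m1 m2 n (A : 'M[C]_(m1, n)) (B : 'M[C]_(m2, n)) :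
  (col_mx A B)^h = row_mx A^h B^h.
Proof. by rewrite /ctmx map_col_mx tr_col_mx. Qed.

Lemma ctmx_block m1 m2 n1 n2 (A : 'M[C]_(m1, n1)) (B : 'M[C]_(m1, n2))
    (D : 'M[C]_(m2, n1)) (E : 'M[C]_(m2, n2)) :
  (block_mx A B D E)^h = block_mx A^h D^h B^h E^h.
Proof. by rewrite /ctmx map_block_mx tr_block_mx. Qed.

Lemma ctmxE m n (A : 'M[C]_(m, n)) i j : A^h i j = (A j i)^*.
Proof. by rewrite !mxE. Qed.

Lemma ctmx_inj m n : injective (@ctmx C m n).
Proof. by move=> A B /(congr1 (@ctmx _ _ _)); rewrite !ctmxK. Qed.

Lemma mxrank_ctmx m n (A : 'M[C]_(m, n)) : \rank A^h = \rank A.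
Proof. by rewrite /ctmx mxrank_tr mxrank_map. Qed.

Lemma row_free_ctmx m n (A : 'M[C]_(m, n)) : row_free A^h = row_full A.
Proof. by rewrite /row_free /row_full mxrank_ctmx. Qed.

Lemma ctmx_congr m n (S : 'M[C]_(m, n)) (H : 'M[C]_n) :
  H^h = H -> (S *m H *m S^h)^h = S *m H *m S^h.
Proof. by move=> hH; rewrite !ctmxM ctmxK hH mulmxA. Qed.

End ConjugateTranspose.

(** * Inertia, spectral decomposition and positive frames *)

Section Inertia.
Variable C : numClosedFieldType.
Implicit Types k m n p : nat.

(** Similar matrices share their characteristic polynomial, and a monic split polynomial determines
    its roots only up to order; since [eigvals] is some chosen list of roots, [perm_eq] is the right
    comparison. *)
Lemma eigvals_similar_diag n (S : 'M[C]_n) (d : 'rV[C]_n) : S \in unitmx ->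
  perm_eq (eigvals (invmx S *m diag_mx d *m S)) [seq d 0 i | i <- enum 'I_n].
Proof.
move=> uS; set H := (_ *m S).
have cH : char_poly H = \prod_(x <- [seq d 0 i | i <- enum 'I_n]) ('X - x%:P).
  have uP : map_mx (@polyC C) S \in unitmx by rewrite map_unitmx.
  have -> : char_poly H = char_poly (diag_mx d).
    rewrite /char_poly /char_poly_mx /H !map_mxM map_invmx.
    set P := map_mx _ S in uP *.
    rewrite [X in \det (X - _)](_ : _ = invmx P *m 'X%:M *m P); last first.
      by rewrite scalar_mxC -mulmxA mulVmx // mulmx1.
    rewrite -mulmxBl -mulmxBr !det_mulmx mulrC mulrA -det_mulmx mulmxV //.
    by rewrite det1 mul1r.
  rewrite char_poly_trig ?diag_mx_is_trig // big_map enumT.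
  by apply: eq_bigr => i _; rewrite mxE eqxx.
rewrite /eigvals; case: closed_field_poly_normal => s /= Es.
apply: prod_XsubC_eq; rewrite -cH Es.
by rewrite (monicP (char_poly_monic H)) scale1r.
Qed.

Lemma herm_spectral n (H : 'M[C]_n) : H^h = H ->
  exists S : 'M[C]_n, exists d : 'rV[C]_n,
    [/\ S *m S^h = 1%:M, H = S^h *m diag_mx d *m S,
        forall i, d 0 i \is Num.real
      & perm_eq (eigvals H) [seq d 0 i | i <- enum 'I_n]].
Proof.
move=> hH.
have hs : H \is hermsymmx.
  by apply/is_hermitianmxP; rewrite expr0 scale1r -{1}hH /ctmx map_trmx.
have uS := spectral_unitarymx H; have unS := spectral_unit H.
have Si : invmx (spectralmx H) = (spectralmx H)^h.
  by rewrite invmx_unitary // /ctmx map_trmx.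
have Ed := orthomx_spectralP (hermitian_normalmx hs).
exists (spectralmx H), (spectral_diag H); split.
- by rewrite -Si mulmxV.
- by rewrite -Si.
- by move=> i; exact: (mxOverP (hermitian_spectral_diag_real hs)).
- by rewrite {1}Ed; apply: eigvals_similar_diag.
Qed.

Lemma herm_inertia n (H : 'M[C]_n) : H^h = H ->
  exists S : 'M[C]_n, exists d : 'rV[C]_n,
    [/\ S *m S^h = 1%:M, H = S^h *m diag_mx d *m S,
        forall i, d 0 i \is Num.real,
        ipos H = #|[set i | 0 < d 0 i]| & ineg H = #|[set i | d 0 i < 0]|].
Proof.
move=> hH; have [S [d [uS EH rd pe]]] := herm_spectral hH.
exists S, d; split=> //; rewrite /ipos /ineg (permP pe) count_map.
  by rewrite enumT -size_filter cardsE cardE /enum_mem.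
by rewrite enumT -size_filter cardsE cardE /enum_mem.
Qed.

(** The rows are unit eigenvectors for positive eigenvalues, divided by the square roots of these
    eigenvalues. Together with [ipos_ge_frame] this characterizes [ipos] by frames, so that later
    arguments avoid eigenvalues. *)
Lemma ipos_frame n (H : 'M[C]_n) k : H^h = H -> (k <= ipos H)%N ->
  exists P : 'M[C]_(k, n), P *m H *m P^h = 1%:M.
Proof.
move=> hH; have [S [d [uS EH rd -> _]]] := herm_inertia hH.
move=> lek; pose f (i : 'I_k) := enum_val (widen_ord lek i).
have fpos i : 0 < d 0 (f i) by have := enum_valP (widen_ord lek i); rewrite inE.
have finj : injective f by move=> i j /enum_val_inj /(congr1 val) /= /val_inj.
pose T : 'M[C]_(k, n) :=
  \matrix_(i, j) (if j == f i then (sqrtC (d 0 (f i)))^-1 else 0).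
exists (T *m S).
have -> : T *m S *m H *m (T *m S)^h = T *m diag_mx d *m T^h.
  rewrite EH ctmxM !mulmxA -(mulmxA T) uS mulmx1.
  by rewrite -(mulmxA _ S) uS mulmx1.
rewrite mul_mx_diag; apply/matrixP=> i j.
rewrite mxE (bigD1 (f i)) //= big1 => [|l nl]; last first.
  by rewrite !mxE (negPf nl) !mul0r.
rewrite !mxE !eqxx addr0 (inj_eq finj).
case: (eqVneq i j) => [<-|_]; last by rewrite conjC0 mulr0.
set x := d 0 (f i); have x0 : 0 < x := fpos i.
rewrite conj_Creal ?rpredV ?ger0_real ?sqrtC_ge0 1?ltW //.
rewrite -{2}[x]sqrtCK expr2 mulrA mulVf ?mul1r ?mulfV // sqrtC_eq0 gt_eqF //.
Qed.

(** The row space of [P] meets the span [N] of the eigenvectors with nonpositive eigenvalues only in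
    0, so their dimensions add up to at most n. *)
Lemma ipos_ge_posdef n (H : 'M[C]_n) k (P : 'M[C]_(k, n)) : H^h = H ->
  (forall v : 'rV[C]_k, v != 0 -> 0 < (v *m (P *m H *m P^h) *m v^h) 0 0) ->
  (k <= ipos H)%N.
Proof.
move=> hH pd; have [S [d [uS EH rd -> _]]] := herm_inertia hH.
set A := [set i | _]; pose g (i : 'I_#|~: A|) := enum_val i.
pose N := rowsub g S.
have gA i : g i \in ~: A by exact: enum_valP.
have NS i j : (N *m S^h) i j = (g i == j)%:R.
  have := congr1 (fun M : 'M_n => M (g i) j) uS; rewrite !mxE => <-.
  by apply: eq_bigr => l _; rewrite !mxE.
have rN : row_free N.
  apply/row_freeP; exists N^h; apply/matrixP=> i j.
  rewrite [RHS]mxE -(inj_eq enum_val_inj) -NS [LHS]mxE [RHS]mxE.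
  by apply: eq_bigr => l _; rewrite !mxE.
have neg (w : 'rV_#|~: A|) : (w *m N *m H *m (w *m N)^h) 0 0 <= 0.
  set u := w *m N *m S^h.
  have -> : w *m N *m H *m (w *m N)^h = u *m diag_mx d *m u^h.
    by rewrite /u EH !ctmxM ctmxK !mulmxA.
  rewrite mxE big_seq; apply: sumr_le0 => j _.
  rewrite mul_mx_diag !mxE mulrAC -normCK.
  have [jA|jA] := boolP (j \in A).
    suff -> : \sum_k0 (w *m N) 0 k0 * S^h k0 j = 0 by rewrite normr0 expr0n mul0r.
    transitivity (u 0 j); first by rewrite mxE.
    rewrite /u -mulmxA mxE big1 // => l _; rewrite NS.
    case: eqP => [E|_]; last by rewrite mulr0.
    by have := gA l; rewrite inE E jA.
  rewrite mulr_ge0_le0 ?exprn_ge0 // real_leNgt ?rd ?real0 //.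
  by move: jA; rewrite inE.
have rP : row_free P.
  rewrite -kermx_eq0; apply/eqP/row_matrixP => i; rewrite row0; apply/eqP.
  apply/negPn/negP => /pd.
  have -> : row i (kermx P) *m (P *m H *m P^h) *m (row i (kermx P))^h = 0.
    by rewrite !mulmxA -row_mul mulmx_ker row0 !mul0mx.
  by rewrite mxE ltxx.
have cap0 : (P :&: N = 0)%MS.
  apply/eqP/rowV0P => v; rewrite sub_capmx => /andP[/submxP[x Ex] /submxP[y Ey]].
  have [x0|nx0] := eqVneq x 0; first by rewrite Ex x0 mul0mx.
  have := pd _ nx0; have := neg y; rewrite -Ey Ex ctmxM !mulmxA => h1 h2.
  by have := lt_le_trans h2 h1; rewrite ltxx.
have := mxrank_sum_cap P N; rewrite cap0 mxrank0 addn0 (eqP rP) (eqP rN) => E.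
have := rank_leq_col (P + N)%MS; rewrite E cardsCs setCK card_ord.
have := max_card (mem A); rewrite card_ord; lia.
Qed.

Lemma dot_gt0 n (v : 'rV[C]_n) : v != 0 -> 0 < (v *m v^h) 0 0.
Proof.
move=> nv; rewrite mxE (eq_bigr (fun j => `|v 0 j| ^+ 2)) => [|j _]; last first.
  by rewrite ctmxE normCK.
rewrite lt_def sumr_ge0 ?andbT => [|j _]; last exact: exprn_ge0.
apply: contra nv => /eqP s0; apply/eqP/rowP => j; rewrite mxE; apply/eqP.
rewrite -normr_eq0 -sqrf_eq0; apply/eqP.
by apply: (psumr_eq0P _ s0) => // l _; exact: exprn_ge0.
Qed.

Lemma ipos_ge_frame n (H : 'M[C]_n) k (P : 'M[C]_(k, n)) :
  H^h = H -> P *m H *m P^h = 1%:M -> (k <= ipos H)%N.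
Proof.
move=> hH E; apply: (ipos_ge_posdef (P := P)) => // v nv; rewrite E mulmx1.
exact: dot_gt0.
Qed.

Lemma ineg_ipos n (H : 'M[C]_n) : H^h = H -> ineg H = ipos (- H).
Proof.
move=> hH; have [S [d [uS EH rd _ ->]]] := herm_inertia hH.
have uS' := mulmx1C uS.
have unS : S \in unitmx by case/mulmx1_unit: uS.
have Si : invmx S = S^h by rewrite -[LHS]mulmx1 -uS mulmxA mulVmx ?mul1mx.
have EN : - H = invmx S *m diag_mx (- d) *m S.
  by rewrite Si EH raddfN mulmxN mulNmx.
rewrite /ipos EN (permP (eigvals_similar_diag _ unS)) count_map.
rewrite enumT -size_filter cardsE cardE /enum_mem; congr size.
by apply: eq_filter => i; rewrite /= mxE oppr_gt0.
Qed.

Lemma mxrank_diag n (d : 'rV[C]_n) : \rank (diag_mx d) = #|[set i | d 0 i != 0]|.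
Proof.
set D := [set i | _]; pose g (i : 'I_#|D|) := enum_val i.
pose R : 'M[C]_(#|D|, n) := rowsub g 1%:M.
have gD i : d 0 (g i) != 0 by have := enum_valP i; rewrite inE.
have E1 : diag_mx d = R^T *m (R *m diag_mx d).
  apply/matrixP=> i j; rewrite [RHS]mxE mul_mx_diag.
  have [iD|niD] := boolP (i \in D).
    rewrite (bigD1 (enum_rank_in iD i)) //= big1 => [|l nl].
      by rewrite !mxE /g enum_rankK_in // eqxx mul1r addr0 mulr_natl; case: eqP => // ->.
    rewrite !mxE (_ : (g l == i) = false) ?mul0r //.
    apply: contraNF nl => /eqP gl; apply/eqP/enum_val_inj.
    by rewrite enum_rankK_in.
  move: niD; rewrite inE negbK => /eqP d0; rewrite mxE.
  rewrite big1 ?d0 ?mul0rn // => l _; rewrite !mxE.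
  case: (eqVneq (g l) i) => [E|]; last by rewrite mul0r.
  by have := gD l; rewrite E d0 eqxx.
have E2 : R *m diag_mx d *m (R^T *m diag_mx (\row_i (d 0 (g i))^-1)) = 1%:M.
  apply/matrixP=> i j; rewrite mulmxA mul_mx_diag mxE mul_mx_diag !mxE.
  rewrite (bigD1 (g i)) //= big1 => [|l nl]; last first.
    by rewrite !mxE eq_sym (negPf nl) !mul0r.
  rewrite !mxE eqxx mul1r addr0 (inj_eq enum_val_inj) eq_sym.
  by case: (eqVneq i j) => [->|_]; rewrite ?mulr0 ?mul0r // mulr1 mulfV.
apply/eqP; rewrite eqn_leq; apply/andP; split.
  by rewrite E1 (leq_trans (mxrankM_maxl _ _)) // rank_leq_col.
rewrite -[X in (X <= _)%N](mxrank1 C) -E2.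
by rewrite (leq_trans (mxrankM_maxl _ _)) // mxrankM_maxr.
Qed.

Lemma mxrank_herm n (H : 'M[C]_n) : H^h = H -> \rank H = (ipos H + ineg H)%N.
Proof.
move=> hH; have [S [d [uS -> rd -> ->]]] := herm_inertia hH.
have unS : S \in unitmx by case/mulmx1_unit: uS.
rewrite mxrankMfree ?row_free_unit // -mxrank_tr trmx_mul.
rewrite mxrankMfree ?mxrank_tr ?mxrank_diag; last first.
  by rewrite row_free_unit unitmx_tr; case/mulmx1_unit: uS.
set A := [set i | 0 < _]; set B := [set i | _ < 0].
have /leqifP/= := leq_card_setU A B.
rewrite ifT => [/eqP <-|]; last first.
  rewrite disjoints_subset; apply/subsetP => i; rewrite !inE => h.
  by rewrite lt_gtF.
by apply: eq_card => i; rewrite !inE real_neqr_lt ?rd ?real0 // orbC.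
Qed.

End Inertia.

(** * Inertia under compression and extension *)

Section InertiaBounds.
Variable C : numClosedFieldType.
Implicit Types k m n p : nat.

Lemma frame_row_free n (H : 'M[C]_n) k (P : 'M[C]_(k, n)) :
  P *m H *m P^h = 1%:M -> row_free P.
Proof. by move=> E; apply/row_freeP; exists (H *m P^h); rewrite mulmxA. Qed.

Lemma ipos_congr_le m n (S : 'M[C]_(m, n)) (H : 'M[C]_n) :
  H^h = H -> (ipos (S *m H *m S^h) <= ipos H)%N.
Proof.
move=> hH; have [P] := ipos_frame (ctmx_congr S hH) (leqnn _).
rewrite !mulmxA => E; apply: (ipos_ge_frame (P := P *m S) hH).
by rewrite ctmxM !mulmxA.
Qed.

Lemma ineg_congr_le m n (S : 'M[C]_(m, n)) (H : 'M[C]_n) :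
  H^h = H -> (ineg (S *m H *m S^h) <= ineg H)%N.
Proof.
move=> hH; rewrite !ineg_ipos ?ctmx_congr // -mulNmx -mulmxN.
by apply: ipos_congr_le; rewrite ctmxN hH.
Qed.

(** A maximal positive frame [F] meets the row space of [P] in dimension at least ipos H + rank P -
    n, and the compressed form is positive definite on that intersection. *)
Lemma ipos_restrict m n (P : 'M[C]_(m, n)) (H : 'M[C]_n) :
  H^h = H -> (ipos H + \rank P <= ipos (P *m H *m P^h) + n)%N.
Proof.
move=> hH; have [F EF] := ipos_frame hH (leqnn _).
set I := row_base (F :&: P)%MS.
have /submxP[A EA] : (I <= F)%MS by rewrite eq_row_base capmxSl.
have /submxP[B EB] : (I <= P)%MS by rewrite eq_row_base capmxSr.
suff: (\rank (F :&: P) <= ipos (P *m H *m P^h))%N.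
  have := mxrank_sum_cap F P; have := rank_leq_col (F + P)%MS.
  by rewrite (eqP (frame_row_free EF)); lia.
apply: (ipos_ge_posdef (P := B)) => [|v nv]; first exact: ctmx_congr.
have -> : B *m (P *m H *m P^h) *m B^h = A *m A^h.
  rewrite !mulmxA -EB -mulmxA -ctmxM -EB EA ctmxM !mulmxA.
  by rewrite -(mulmxA A) -(mulmxA A) EF mulmx1.
rewrite mulmxA -mulmxA -ctmxM; apply: dot_gt0.
apply: contra nv => /eqP vA; rewrite -(inj_eq (row_free_inj (row_base_free (F :&: P)%MS))).
by rewrite -/I EA mulmxA vA !mul0mx.
Qed.

Lemma ineg_restrict m n (P : 'M[C]_(m, n)) (H : 'M[C]_n) :
  H^h = H -> (ineg H + \rank P <= ineg (P *m H *m P^h) + n)%N.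
Proof.
move=> hH; rewrite !ineg_ipos ?ctmx_congr // -mulNmx -mulmxN.
by apply: ipos_restrict; rewrite ctmxN hH.
Qed.

Lemma ipos_ge_frame_orth k m n (x : 'M[C]_(k, n)) (R : 'M[C]_(m, n)) (H : 'M[C]_n) :
  H^h = H -> x *m H *m x^h = 1%:M -> R *m H *m x^h = 0 ->
  (k + ipos (R *m H *m R^h) <= ipos H)%N.
Proof.
move=> hH xx Rx; have := ipos_frame (ctmx_congr R hH) (leqnn _).
move: (ipos (R *m H *m R^h)) => l [F EF].
have xR : x *m H *m R^h = 0.
  by apply: ctmx_inj; rewrite !ctmxM ctmxK hH ctmx0 mulmxA.
apply: (ipos_ge_frame (P := col_mx x (F *m R)) hH).
rewrite ctmx_col mul_col_mx mul_col_row xx ctmxM.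
rewrite !mulmxA in EF *; rewrite EF xR mul0mx -2!mulmxA (mulmxA R) Rx mulmx0.
by rewrite -scalar_mx_block.
Qed.

(* The vectors y, made orthogonal to the positive frame of R H R^h and shifted
   along the isotropic x, extend that frame. *)
Lemma ipos_ge_isotropic k m n (x y : 'M[C]_(k, n)) (R : 'M[C]_(m, n))
    (H : 'M[C]_n) :
  H^h = H -> x *m H *m x^h = 0 -> x *m H *m y^h = 1%:M -> R *m H *m x^h = 0 ->
  (k + ipos (R *m H *m R^h) <= ipos H)%N.
Proof.
move=> hH xx xy Rx; have := ipos_frame (ctmx_congr R hH) (leqnn _).
move: (ipos (R *m H *m R^h)) => l [F EF].
have yx : y *m H *m x^h = 1%:M.
  by apply: ctmx_inj; rewrite !ctmxM ctmxK hH ctmx1 mulmxA.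
have xR : x *m H *m R^h = 0.
  by apply: ctmx_inj; rewrite !ctmxM ctmxK hH ctmx0 mulmxA.
(* For [z = y + a x] with [x] isotropic, the Gram matrix is that of [y] plus [a + a^h]; this
   Hermitian [a] makes it the identity. *)
pose a := 2^-1 *: (1%:M - y *m H *m y^h).
have ha : a^h = a.
  by rewrite ctmxZ ctmxB ctmx1 ctmx_congr // conj_Creal ?rpredV ?realn.
(* Orthogonality to [y] is obtained by moving the frame [F *m R] along [x]; as [x] is isotropic and
   orthogonal to [R], the Gram matrix of the frame does not change. *)
pose z := y + a *m x; pose P := F *m R - (F *m R *m H *m y^h) *m x.
have zz : z *m H *m z^h = 1%:M.
  have axy : a *m x *m H *m y^h = a.
    by rewrite -!mulmxA (mulmxA x) xy mulmx1.
  have axx : a *m x *m H *m x^h = 0 by rewrite -!mulmxA (mulmxA x) xx mulmx0.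
  rewrite /z ctmxD ctmxM !(mulmxDl, mulmxDr) !mulmxA axy axx yx mul1mx mul0mx.
  rewrite addr0 ha -addrA -scalerDl -div1r -splitr scale1r.
  by rewrite addrC subrK.
have Px : P *m H *m x^h = 0.
  by rewrite /P !mulmxBl -!mulmxA (mulmxA R) Rx (mulmxA x) xx !mulmx0 subr0.
have Py : P *m H *m y^h = 0.
  by rewrite /P !mulmxBl -!mulmxA (mulmxA x) xy mulmx1 subrr.
have PP : P *m H *m P^h = 1%:M.
  have -> : P^h = R^h *m F^h - x^h *m (F *m R *m H *m y^h)^h.
    by rewrite ctmxB !ctmxM.
  have PR : P *m H *m R^h = F *m R *m H *m R^h.
    by rewrite /P !mulmxBl -[X in _ - X]mulmxA -[X in _ - X]mulmxA !mulmxA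
         -(mulmxA _ x) -(mulmxA _ (x *m H)) xR mulmx0 subr0.
  by rewrite mulmxBr mulmxA PR (mulmxA _ x^h) Px mul0mx subr0 -EF !mulmxA.
have zP : z *m H *m P^h = 0.
  apply: ctmx_inj; rewrite ctmx0 ctmxM ctmxK ctmxM hH /z ctmxD ctmxM.
  by rewrite !mulmxDr !mulmxA Py Px mul0mx addr0.
apply: (ipos_ge_frame (P := col_mx z P) hH).
rewrite ctmx_col mul_col_mx mul_col_row zz zP PP.
suff -> : P *m H *m z^h = 0 by rewrite -scalar_mx_block.
by apply: ctmx_inj; rewrite ctmx0 !ctmxM ctmxK hH mulmxA.
Qed.

Lemma ineg_ge_isotropic k m n (x y : 'M[C]_(k, n)) (R : 'M[C]_(m, n))
    (H : 'M[C]_n) :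
  H^h = H -> x *m H *m x^h = 0 -> x *m H *m y^h = 1%:M -> R *m H *m x^h = 0 ->
  (k + ineg (R *m H *m R^h) <= ineg H)%N.
Proof.
move=> hH xx xy Rx; rewrite !ineg_ipos ?ctmx_congr // -mulNmx -mulmxN.
apply: (@ipos_ge_isotropic _ _ _ x (- y)).
- by rewrite ctmxN hH.
- by rewrite mulmxN mulNmx xx oppr0.
- by rewrite ctmxN !mulmxN mulNmx opprK.
- by rewrite mulmxN mulNmx Rx oppr0.
Qed.

Lemma ineg_ge_frame_orth k m n (x : 'M[C]_(k, n)) (R : 'M[C]_(m, n)) (H : 'M[C]_n) :
  H^h = H -> x *m H *m x^h = - 1%:M -> R *m H *m x^h = 0 ->
  (k + ineg (R *m H *m R^h) <= ineg H)%N.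
Proof.
move=> hH xx Rx; rewrite !ineg_ipos ?ctmx_congr // -mulNmx -mulmxN.
apply: (@ipos_ge_frame_orth _ _ _ x).
- by rewrite ctmxN hH.
- by rewrite mulmxN mulNmx xx opprK.
- by rewrite mulmxN mulNmx Rx oppr0.
Qed.

End InertiaBounds.

(** * Rank after removing one row and one column direction *)

Section RankPeeling.
Variable F : fieldType.
Implicit Types m n p k l : nat.

Lemma hyperplane_eq_ker k m (P : 'M[F]_(k, m)) (z : 'cV[F]_m) :
  P *m z = 0 -> (\rank P).+1 = m -> z != 0 -> (P :=: kermx z)%MS.
Proof.
move=> Pz rP nz; have /sub_kermxP sub := Pz.
have rz : \rank z = 1%N.
  by apply/eqP; rewrite eqn_leq rank_leq_col lt0n mxrank_eq0.
apply/eqmxP; rewrite -(geq_leqif (mxrank_leqif_eq sub)).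
by rewrite mxrank_ker rz -[X in (X - _)%N]rP subSS subn0.
Qed.

(** The row space of [P] is the hyperplane killing [M z], so it contains the left kernel of [M];
    multiplying by [P] therefore costs exactly one dimension. *)
Lemma mxrank_peel_row k m n (P : 'M[F]_(k, m)) (M : 'M[F]_(m, n)) (z : 'cV[F]_n) :
  P *m M *m z = 0 -> (\rank P).+1 = m -> M *m z != 0 ->
  \rank M = (\rank (P *m M)).+1.
Proof.
rewrite -mulmxA => Pz rP nz.
have EP := hyperplane_eq_ker Pz rP nz.
have sub : (kermx M <= P)%MS.
  by rewrite EP; apply/sub_kermxP; rewrite mulmxA mulmx_ker mul0mx.
have := mxrank_mul_ker P M; rewrite (capmx_idPr sub) mxrank_ker.
by have := rank_leq_row M; lia.
Qed.

Lemma mxrank_peel_col m n l (Q : 'M[F]_(n, l)) (M : 'M[F]_(m, n)) (w : 'rV[F]_m) :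
  w *m M *m Q = 0 -> (\rank Q).+1 = n -> w *m M != 0 ->
  \rank M = (\rank (M *m Q)).+1.
Proof.
move=> wQ rQ nw; rewrite -mxrank_tr -[in RHS]mxrank_tr trmx_mul.
apply: (@mxrank_peel_row _ _ _ _ _ w^T).
- by rewrite -!trmx_mul mulmxA wQ trmx0.
- by rewrite mxrank_tr.
- by rewrite -trmx_mul -(inj_eq trmx_inj) trmxK trmx0.
Qed.

(** If w M z = 0, then [w] lies in the hyperplane [P] and the row and column peelings each cost one.
    Otherwise [w] is a kernel vector of [M Q] outside [P], so once the column is peeled restricting
    to [P] costs nothing. *)
Lemma mxrank_peel k l m n (M : 'M[F]_(m, n)) (P : 'M[F]_(k, m)) (Q : 'M[F]_(n, l))
    (w : 'rV[F]_m) (z : 'cV[F]_n) :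
  P *m M *m z = 0 -> w *m M *m Q = 0 -> (\rank P).+1 = m -> (\rank Q).+1 = n ->
  M *m z != 0 -> w *m M != 0 ->
  \rank M = (\rank (P *m M *m Q) + (1 + (w *m M *m z == 0%R)))%N.
Proof.
move=> Pz wQ rP rQ nz nw.
have [wz|nwz] := eqVneq (w *m M *m z) 0 => /=.
  have /submxP[u Eu] : (w <= P)%MS.
    rewrite (hyperplane_eq_ker _ rP nz); last by rewrite mulmxA.
    by apply/sub_kermxP; rewrite mulmxA.
  rewrite (mxrank_peel_row Pz rP nz) (@mxrank_peel_col _ _ _ Q _ u) ?addn2 //.
    by rewrite mulmxA -Eu.
  by rewrite mulmxA -Eu.
rewrite (mxrank_peel_col wQ rQ nw) addn1 -mulmxA; congr S.
have wK : (w <= kermx (M *m Q))%MS by apply/sub_kermxP; rewrite mulmxA.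
have := mxrank_mul_ker P (M *m Q).
have := mxrank_sum_cap P (kermx (M *m Q)); rewrite mxrank_ker.
have : (\rank P < \rank (P + kermx (M *m Q)))%N.
  rewrite ltnNge; apply: contra nwz => h.
  have : (P + kermx (M *m Q) <= P)%MS.
    by rewrite -(geq_leqif (mxrank_leqif_sup _)) ?addsmxSl.
  rewrite addsmx_sub submx_refl /= => /(submx_trans wK)/submxP[u ->].
  by rewrite -!mulmxA (mulmxA P) Pz mulmx0.
have := rank_leq_col (P + kermx (M *m Q))%MS; have := rank_leq_row (M *m Q).
lia.
Qed.

End RankPeeling.

(** * Splitting off nondegenerate pieces orthogonal to the variable term *)

Section Reduction.
Variable C : numClosedFieldType.
Implicit Types k l m n p g s t : nat.

Lemma ctmx_neq0 m n (A : 'M[C]_(m, n)) : (A^h != 0) = (A != 0).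
Proof. by rewrite -[in RHS](inj_eq (@ctmx_inj C m n)) ctmx0. Qed.

Lemma scalar_mx11_eq0 (c : C) : (c%:M == 0 :> 'M[C]_1) = (c == 0).
Proof.
by apply/eqP/eqP => [/matrixP/(_ 0 0)|->]; rewrite ?raddf0 // !mxE eqxx.
Qed.

(* Same statement, but with the matrix products elaborated in the
   [numClosedFieldType] structure, so that [lia] identifies them. *)
Lemma mxrank_peelC k l m n (M : 'M[C]_(m, n)) (P : 'M[C]_(k, m))
    (Q : 'M[C]_(n, l)) (w : 'rV[C]_m) (z : 'cV[C]_n) :
  P *m M *m z = 0 -> w *m M *m Q = 0 -> (\rank P).+1 = m -> (\rank Q).+1 = n ->
  M *m z != 0 -> w *m M != 0 ->
  \rank M = (\rank (P *m M *m Q) + (1 + (w *m M *m z == 0%R)))%N.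
Proof. exact: mxrank_peel. Qed.

Lemma herm_form_real n (H : 'M[C]_n) (x : 'rV[C]_n) :
  H^h = H -> (x *m H *m x^h) 0 0 \is Num.real.
Proof.
by move=> hH; apply/CrealP; rewrite -[LHS]ctmxE ctmx_congr.
Qed.

(** A vector with c nonzero spans a definite line. If c = 0, then [x] is isotropic but outside the
    radical and lies in a hyperbolic plane, which adds one to both indices; hence the non-strict
    comparisons. Frames give lower bounds only, and the rank count of [mxrank_peelC] turns them into
    equalities. *)
Lemma peel_inertia k n (M : 'M[C]_n) (P : 'M[C]_(k, n)) (x : 'rV[C]_n) :
  M^h = M -> P *m M *m x^h = 0 -> (\rank P).+1 = n -> x *m M != 0 ->
  let c := (x *m M *m x^h) 0 0 in
  ipos M = ((0 <= c)%R + ipos (P *m M *m P^h))%N /\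
  ineg M = ((c <= 0)%R + ineg (P *m M *m P^h))%N.
Proof.
move=> hM Px rP nx c.
have cE : x *m M *m x^h = c%:M by rewrite [LHS]mx11_scalar.
have xP : x *m M *m P^h = 0 by apply: ctmx_inj; rewrite !ctmxM ctmxK hM ctmx0 mulmxA.
have Mx : M *m x^h != 0 by rewrite -ctmx_neq0 ctmxM ctmxK hM.
have := mxrank_peelC Px xP rP _ Mx nx; rewrite mxrank_ctmx => /(_ rP).
rewrite !mxrank_herm ?ctmx_congr // cE scalar_mx11_eq0.
have cR : c \is Num.real by exact: herm_form_real.
have scaled (a : C) (e : C) : a^* = a -> a * c * a = e -> (a *: x) *m M *m (a *: x)^h = e%:M.
  move=> aR <-; rewrite ctmxZ aR -scalemxAr -!scalemxAl cE !scale_scalar_mx.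
  by rewrite mulrC.
have Px' a : P *m M *m (a *: x)^h = 0 by rewrite ctmxZ -scalemxAr Px scaler0.
case: (real_ltgt0P cR) => hc.
- rewrite /= addn0 => E.
  have h1 : (1 + ipos (P *m M *m P^h) <= ipos M)%N.
    apply: (@ipos_ge_frame_orth _ _ _ _ ((sqrtC c)^-1 *: x)) => //.
    apply: scaled; first by rewrite conj_Creal // rpredV ger0_real // sqrtC_ge0 ltW.
    by rewrite -{2}[c]sqrtCK expr2 mulrA mulVf ?mul1r ?mulfV // sqrtC_eq0 gt_eqF.
  have := ineg_congr_le P hM. lia.
- rewrite /= addn0 => E.
  have h1 : (1 + ineg (P *m M *m P^h) <= ineg M)%N.
    apply: (@ineg_ge_frame_orth _ _ _ _ ((sqrtC (- c))^-1 *: x)) => //.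
    rewrite -scaleN1r scalemx1.
    apply: scaled.
      by rewrite conj_Creal // rpredV ger0_real // sqrtC_ge0 oppr_ge0 ltW.
    rewrite -{2}[c]opprK -{2}[- c]sqrtCK expr2 mulrN mulNr mulrA.
    by rewrite mulVf ?mul1r ?mulfV // sqrtC_eq0 oppr_eq0 lt_eqF.
  by have := ipos_congr_le P hM; lia.
rewrite /= => E.
pose d := (x *m M *m (x *m M)^h) 0 0.
have d0 : 0 < d by exact: dot_gt0.
pose y := d^-1 *: (x *m M).
have xx : x *m M *m x^h = 0 by rewrite cE hc raddf0.
have xy : x *m M *m y^h = 1%:M.
  rewrite ctmxZ -scalemxAr [X in _ *: X]mx11_scalar -/d scale_scalar_mx.
  by rewrite conj_Creal ?rpredV ?gtr0_real // mulVf // gt_eqF.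
have := ipos_ge_isotropic hM xx xy Px; have := ineg_ge_isotropic hM xx xy Px.
lia.
Qed.

(** With zero-width borders this is also [H] itself or a plain row block [H, U], so one reduction
    statement covers every rank and inertia involved. *)
Definition bordered n s t (H : 'M[C]_n) (U : 'M[C]_(n, s)) (V : 'M[C]_(t, n)) :=
  block_mx H U V (0 : 'M[C]_(t, s)).

Lemma bordered_congr k n s t (P : 'M[C]_(k, n)) (H : 'M[C]_n)
    (U : 'M[C]_(n, s)) (V : 'M[C]_(t, n)) :
  block_mx P 0 0 1%:M *m bordered H U V *m (block_mx P^h 0 0 1%:M) =
  bordered (P *m H *m P^h) (P *m U) (V *m P^h).
Proof.
rewrite /bordered !mulmx_block !(mul0mx, mulmx0, mul1mx, mulmx1).
by rewrite !(addr0, add0r).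
Qed.

Lemma bordered_herm n s (H : 'M[C]_n) (U : 'M[C]_(n, s)) :
  H^h = H -> (bordered H U U^h)^h = bordered H U U^h.
Proof. by move=> hH; rewrite ctmx_block hH ctmxK ctmx0. Qed.

Section Peel.
Variables (n k : nat) (H : 'M[C]_n) (P : 'M[C]_(k, n)) (x : 'rV[C]_n).
Hypotheses (hH : H^h = H) (Px : P *m H *m x^h = 0) (rP : (\rank P).+1 = n).
Hypothesis nx : x *m H != 0.
Let c := (x *m H *m x^h) 0 0.

(** Since [x] kills the border, padding it with zeros gives a vector that can be peeled from the
    bordered matrix, with the same value [c]. *)
Lemma bordered_peel_inertia s (U : 'M[C]_(n, s)) : x *m U = 0 ->
  ipos (bordered H U U^h) =
    ((0 <= c)%R + ipos (bordered (P *m H *m P^h) (P *m U) (P *m U)^h))%N /\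
  ineg (bordered H U U^h) =
    ((c <= 0)%R + ineg (bordered (P *m H *m P^h) (P *m U) (P *m U)^h))%N.
Proof.
move=> xU; rewrite [(P *m U)^h]ctmxM -bordered_congr.
have Ux : U^h *m x^h = 0 by rewrite -ctmxM xU ctmx0.
have -> : block_mx P^h 0 0 1%:M = (block_mx P 0 0 1%:M : 'M_(k + s, n + s))^h.
  by rewrite ctmx_block ctmx1 !ctmx0.
have xM : row_mx x 0 *m bordered H U U^h = row_mx (x *m H) 0.
  by rewrite /bordered mul_row_block xU !mul0mx !addr0.
have -> : c = (row_mx x 0 *m bordered H U U^h *m (row_mx x (0 : 'M_(1, s)))^h) 0 0.
  by rewrite xM ctmx_row mul_row_col mul0mx addr0.
apply: peel_inertia; first exact: bordered_herm.
- rewrite ctmx_row ctmx0 /bordered !mulmx_block mul_block_col.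
  by rewrite !(mul0mx, mulmx0, mul1mx, mulmx1, addr0, add0r) Px Ux col_mx0.
- by rewrite rank_diag_block_mx mxrank1 -addSn rP.
- by rewrite xM -mxrank_eq0 rank_row_mx0 mxrank_eq0.
Qed.

Lemma bordered_peel_rank s t (U : 'M[C]_(n, s)) (V : 'M[C]_(t, n)) :
  x *m U = 0 -> V *m x^h = 0 ->
  \rank (bordered H U V) =
    ((0 <= c)%R + (c <= 0)%R + \rank (bordered (P *m H *m P^h) (P *m U) (V *m P^h)))%N.
Proof.
move=> xU Vx; rewrite -bordered_congr.
have xP : x *m H *m P^h = 0 by apply: ctmx_inj; rewrite !ctmxM ctmxK hH ctmx0 mulmxA.
have xM : row_mx x 0 *m bordered H U V = row_mx (x *m H) 0.
  by rewrite /bordered mul_row_block xU !mul0mx !addr0.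
have Mx : bordered H U V *m col_mx x^h 0 = col_mx (H *m x^h) 0.
  by rewrite /bordered mul_block_col Vx !mulmx0 !addr0.
rewrite (@mxrank_peelC _ _ _ _ _ (block_mx P 0 0 1%:M) (block_mx P^h 0 0 1%:M)
  (row_mx x 0) (col_mx x^h 0)).
- rewrite xM mul_row_col mul0mx addr0 [X in _ (1 + (X == _))%N]mx11_scalar -/c.
  rewrite scalar_mx11_eq0 addnC; congr addn.
  by case: (real_ltgt0P (herm_form_real x hH)).
- by rewrite -mulmxA Mx mul_block_col mulmxA Px !(mul0mx, mulmx0) !addr0 col_mx0.
- by rewrite xM mul_row_block xP !(mul0mx, mulmx0) !addr0 row_mx0.
- by rewrite rank_diag_block_mx mxrank1 -addSn rP.
- by rewrite rank_diag_block_mx mxrank1 mxrank_ctmx -addSn rP.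
- by rewrite Mx -mxrank_eq0 rank_col_mx0 mxrank_eq0 -ctmx_neq0 ctmxM ctmxK hH.
- by rewrite xM -mxrank_eq0 rank_row_mx0 mxrank_eq0.
Qed.

End Peel.

(** Induction on the rank of [H], peeling a row of [kermx G] that is not in the radical. The shifts
    [kp] and [kn] are chosen before [Om], [W] and [Z]: [Om] later carries the unknown [X], while [W]
    and [Z] select the columns [E] or [F] of [G]. *)
Lemma isotropic_reduction n g (H : 'M[C]_n) (G : 'M[C]_(n, g)) : H^h = H ->
  exists H' : 'M[C]_n, exists G' : 'M[C]_(n, g), exists kp kn : nat,
  [/\ H'^h = H', kermx G' *m H' = 0,
     forall (Om : 'M[C]_g) s (W : 'M[C]_(g, s)), Om^h = Om ->
       let M := bordered (H + G *m Om *m G^h) (G *m W) (G *m W)^h in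
       let M' := bordered (H' + G' *m Om *m G'^h) (G' *m W) (G' *m W)^h in
       ipos M = (kp + ipos M')%N /\ ineg M = (kn + ineg M')%N
   & forall s t (W : 'M[C]_(g, s)) (Z : 'M[C]_(g, t)),
       \rank (bordered H (G *m W) (G *m Z)^h) =
       (kp + kn + \rank (bordered H' (G' *m W) (G' *m Z)^h))%N].
Proof.
have [r] := ubnP (\rank H); elim: r H G => // r IH H G /ltnSE-rH hH.
have [K0|nK] := eqVneq (kermx G *m H) 0.
  by exists H, G, 0%N, 0%N; split.
have [i nx] : exists i, row i (kermx G) *m H != 0.
  apply/existsP; apply: contraR nK; rewrite negb_exists => /forallP h.
  by apply/eqP/row_matrixP => i; rewrite row0 row_mul; apply/eqP/negPn/h.
set x := row i _ in nx.
have xG : x *m G = 0 by rewrite -row_mul mulmx_ker row0.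
have Gx : G^h *m x^h = 0 by rewrite -ctmxM xG ctmx0.
have nz : H *m x^h != 0 by rewrite -ctmx_neq0 ctmxM ctmxK hH.
(* The [H]-orthogonal hyperplane of [x], given by an n by n matrix: the redundant row keeps the size
   fixed, so the induction hypothesis applies to [P H P^h]. *)
pose P := kermx (H *m x^h).
have Px : P *m H *m x^h = 0 by rewrite -mulmxA mulmx_ker.
have rP : (\rank P).+1 = n.
  have rz : \rank (H *m x^h) = 1%N.
    by apply/eqP; rewrite eqn_leq rank_leq_col lt0n mxrank_eq0.
  have := rank_leq_row (H *m x^h); rewrite mxrank_ker rz subn1.
  exact: prednK.
have rPH : (\rank (P *m H *m P^h) < r)%N.
  have := mxrank_peel_row Px rP nz; have := mxrankM_maxl (P *m H) P^h; lia.
clearbody P.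
have [H' [G' [kp [kn [hH' K' in' rk']]]]] := IH _ (P *m G) rPH (ctmx_congr P hH).
pose c := (x *m H *m x^h) 0 0.
exists H', G', ((0 <= c)%R + kp)%N, ((c <= 0)%R + kn)%N; split=> //.
- move=> Om s W hOm M M'; rewrite /M.
  set HO := H + _.
  have xHO : x *m HO = x *m H by rewrite mulmxDr !mulmxA xG !mul0mx addr0.
  have hHO : HO^h = HO by rewrite /HO ctmxD hH ctmx_congr.
  have PHO : P *m HO *m x^h = 0.
    by rewrite mulmxDr mulmxDl Px -!mulmxA Gx !mulmx0 add0r.
  have EHO : P *m HO *m P^h = P *m H *m P^h + P *m G *m Om *m (P *m G)^h.
    by rewrite mulmxDr mulmxDl ctmxM !mulmxA.
  have := @bordered_peel_inertia _ _ _ _ x hHO PHO rP _ _ (G *m W).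
  rewrite xHO mulmxA xG mul0mx => /(_ nx erefl) [-> ->].
  by rewrite EHO !mulmxA; have [-> ->] := in' _ _ W hOm; rewrite !addnA.
- move=> s t W Z; rewrite (bordered_peel_rank hH Px rP nx).
  + by rewrite -ctmxM !mulmxA rk' addnA addnACA.
  + by rewrite mulmxA xG mul0mx.
  + by rewrite -ctmxM mulmxA xG mul0mx ctmx0.
Qed.

End Reduction.

(** * Extremal Hermitian completions of two diagonal blocks *)

Section Completion.
Variable C : numClosedFieldType.
Implicit Types a b k l m n p : nat.

Lemma ipos_eq0 n (H : 'M[C]_n) : H^h = H ->
  (forall v : 'rV[C]_n, (v *m H *m v^h) 0 0 <= 0) -> ipos H = 0%N.
Proof.
move=> hH neg; apply/eqP; rewrite -leqn0 leqNgt; apply/negP => h.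
have [P EP] := ipos_frame hH h.
by have := neg P; rewrite EP mxE eqxx /= ler10.
Qed.

Lemma ipos_leq n (H : 'M[C]_n) : H^h = H -> (ipos H <= n)%N.
Proof.
by move=> hH; rewrite (leq_trans _ (rank_leq_row H)) // mxrank_herm // leq_addr.
Qed.

Lemma dot_ge0 n (v : 'rV[C]_n) : 0 <= (v *m v^h) 0 0.
Proof.
by have [->|/dot_gt0/ltW//] := eqVneq v 0; rewrite mul0mx mxE.
Qed.

Lemma herm_gram n k (Q : 'M[C]_(n, k)) : (Q *m Q^h)^h = Q *m Q^h.
Proof. by rewrite ctmxM ctmxK. Qed.

(** On the left kernel of [Q], of codimension at most k, the form is -Q' Q'^h and has no positive
    direction. *)
Lemma ipos_gram_diff_le n k l (Q : 'M[C]_(n, k)) (Q' : 'M[C]_(n, l)) :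
  (ipos (Q *m Q^h - Q' *m Q'^h) <= k)%N.
Proof.
set H := _ - _; have hH : H^h = H by rewrite ctmxB !herm_gram.
have := ipos_restrict (kermx Q) hH.
rewrite (@ipos_eq0 _ (kermx Q *m _ *m _)) ?ctmx_congr //; last first.
  have neg (w : 'rV_n) : w *m Q = 0 -> (w *m H *m w^h) 0 0 <= 0.
    move=> wQ; have -> : w *m H *m w^h = - (w *m Q' *m (w *m Q')^h).
      by rewrite mulmxBr mulmxBl !ctmxM !mulmxA wQ !mul0mx sub0r.
    by rewrite mxE oppr_le0; exact: dot_ge0.
  move=> v.
  have -> : v *m (kermx Q *m H *m (kermx Q)^h) *m v^h =
      (v *m kermx Q) *m H *m (v *m kermx Q)^h.
    by rewrite [(v *m _)^h]ctmxM !mulmxA.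
  apply: neg.
  by rewrite -mulmxA mulmx_ker mulmx0.
rewrite mxrank_ker; have := rank_leq_col Q; have := rank_leq_row Q; lia.
Qed.

Lemma ineg_gram_diff_le n k l (Q : 'M[C]_(n, k)) (Q' : 'M[C]_(n, l)) :
  (ineg (Q *m Q^h - Q' *m Q'^h) <= l)%N.
Proof.
by rewrite ineg_ipos ?ctmxB ?herm_gram // opprB; exact: ipos_gram_diff_le.
Qed.

(** [R] projects off a maximal positive frame [P], and [Q = H P^h] absorbs what is removed. A
    positive direction left in the remainder would enlarge the frame. *)
Lemma herm_split_pos n (H : 'M[C]_n) : H^h = H ->
  exists Q : 'M[C]_(n, ipos H), exists R : 'M[C]_n,
    H = Q *m Q^h + R *m H *m R^h /\ ipos (R *m H *m R^h) = 0%N.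
Proof.
move=> hH; have [P EP] := ipos_frame hH (leqnn _).
exists (H *m P^h), (1%:M - H *m P^h *m P).
set R := 1%:M - _.
have RP : R *m H *m P^h = 0.
  by rewrite /R !mulmxBl mul1mx -!mulmxA (mulmxA P) EP mulmx1 subrr.
split.
  have -> : R *m H *m R^h = R *m H.
    rewrite /R ctmxB ctmx1 !ctmxM ctmxK -/R mulmxBr mulmx1 !mulmxA RP.
    by rewrite !mul0mx subr0.
  by rewrite /R mulmxBl mul1mx ctmxM ctmxK hH !mulmxA addrC subrK.
have := ipos_ge_frame_orth hH EP RP; lia.
Qed.

Lemma gram_widen n k l (Q : 'M[C]_(n, k)) : (k <= l)%N ->
  exists Q' : 'M[C]_(n, l), Q *m Q^h = Q' *m Q'^h.
Proof.
move=> /subnKC <-; exists (row_mx Q 0).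
by rewrite ctmx_row mul_row_col ctmx0 mul0mx addr0.
Qed.

Lemma herm_factor n k l (H : 'M[C]_n) : H^h = H ->
  (ipos H <= k)%N -> (ineg H <= l)%N ->
  exists Q : 'M[C]_(n, k), exists Q' : 'M[C]_(n, l), H = Q *m Q^h - Q' *m Q'^h.
Proof.
move=> hH lek lel; have [Q [R [EH p0]]] := herm_split_pos hH.
set H1 := R *m H *m R^h in EH p0; have hH1 : H1^h = H1 by exact: ctmx_congr.
have hN1 : (- H1)^h = - H1 by rewrite ctmxN hH1.
have [Q' [R' [EH1 n0]]] := herm_split_pos hN1.
have hH2 : (R' *m - H1 *m R'^h)^h = R' *m - H1 *m R'^h by exact: ctmx_congr.
(* After the positive and then the negative part is removed, both indices vanish, and so does the
   rank. *)
have H20 : R' *m - H1 *m R'^h = 0.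
  apply/eqP; rewrite -mxrank_eq0 mxrank_herm // n0 ineg_ipos //.
  by rewrite -mulNmx -mulmxN opprK add0n -leqn0 -p0 ipos_congr_le.
have [Q1 E1] := gram_widen Q lek.
have le1 : (ipos (- H1) <= l)%N.
  by rewrite -ineg_ipos // (leq_trans _ lel) // ineg_congr_le.
have [Q2 E2] := gram_widen Q' le1.
exists Q1, Q2; rewrite -E1 -E2; apply: etrans EH _; congr (_ + _).
by apply: oppr_inj; rewrite opprK; apply: etrans EH1 _; rewrite H20 addr0.
Qed.

(** Both blocks are written as differences of Gram matrices with the same two widths, the maxima of
    their indices. The off-diagonal block formed from the same factors makes the whole matrix such a
    difference, which bounds both indices simultaneously. *)
Lemma completion_min a b (D1 : 'M[C]_a) (D2 : 'M[C]_b) : D1^h = D1 -> D2^h = D2 ->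
  exists Y : 'M[C]_(a, b),
    (ipos (block_mx D1 Y Y^h D2) <= maxn (ipos D1) (ipos D2))%N /\
    (ineg (block_mx D1 Y Y^h D2) <= maxn (ineg D1) (ineg D2))%N.
Proof.
move=> h1 h2.
have [Q1 [Q1' E1]] := herm_factor h1 (leq_maxl _ (ipos D2)) (leq_maxl _ (ineg D2)).
have [Q2 [Q2' E2]] := herm_factor h2 (leq_maxr (ipos D1) _) (leq_maxr (ineg D1) _).
exists (Q1 *m Q2^h - Q1' *m Q2'^h).
set W := block_mx _ _ _ _.
have -> : W = col_mx Q1 Q2 *m (col_mx Q1 Q2)^h - col_mx Q1' Q2' *m (col_mx Q1' Q2')^h.
  rewrite !ctmx_col !mul_col_row opp_block_mx add_block_mx -E1 -E2 /W.
  by rewrite ctmxB !ctmxM !ctmxK.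
by split; [exact: ipos_gram_diff_le | exact: ineg_gram_diff_le].
Qed.

Lemma row_free_sub n m k (A : 'M[C]_(m, n)) : (k <= \rank A)%N ->
  exists2 R : 'M[C]_(k, n), row_free R & (R <= A)%MS.
Proof.
move=> lek; exists (pid_mx k *m row_base A); last first.
  by rewrite (submx_trans (submxMl _ _)) // eq_row_base.
by rewrite /row_free mxrankMfree ?row_base_free // rank_pid_mx.
Qed.

Lemma row_free_col_mx m1 m2 n k (A : 'M[C]_(m1, n)) (B : 'M[C]_(m2, n))
    (J : 'M[C]_(n, k)) :
  row_free (A *m J) -> B *m J = 0 -> row_free B -> row_free (col_mx A B).
Proof.
move=> fA BJ fB.
have cap0 : (A :&: B = 0)%MS.
  apply/eqP/rowV0P => v; rewrite sub_capmx => /andP[/submxP[u Eu] /submxP[w Ew]].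
  have : u *m (A *m J) = 0 by rewrite mulmxA -Eu Ew -mulmxA BJ mulmx0.
  by rewrite -(mul0mx _ (A *m J)) => /(row_free_inj fA) u0; rewrite Eu u0 mul0mx.
have rA : \rank A = m1.
  by apply/eqP; rewrite eqn_leq rank_leq_row -{1}(eqP fA) mxrankM_maxl.
by rewrite /row_free -addsmxE mxrank_disjoint_sum // rA (eqP fB).
Qed.

Lemma frame_extend n k (H : 'M[C]_n) : H^h = H -> (k + ipos H <= n)%N ->
  exists P : 'M[C]_(ipos H, n), exists R : 'M[C]_(k, n),
    [/\ P *m H *m P^h = 1%:M, R *m H *m P^h = 0 & row_free (col_mx P R)].
Proof.
move=> hH le; have [P EP] := ipos_frame hH (leqnn _).
have le' : (k <= \rank (kermx (H *m P^h)))%N.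
  rewrite mxrank_ker; have := rank_leq_col (H *m P^h); lia.
have [R fR /sub_kermxP RP] := row_free_sub le'.
exists P, R; split=> //; first by rewrite -mulmxA.
apply: row_free_col_mx RP fR; rewrite mulmxA EP.
by rewrite row_free_unit unitmx1.
Qed.

Lemma ipos1 n : ipos (1%:M : 'M[C]_n) = n.
Proof.
apply/eqP; rewrite eqn_leq ipos_leq ?ctmx1 //=.
by apply: (ipos_ge_frame (P := 1%:M)); rewrite !ctmx1 ?mulmx1.
Qed.

Lemma block_herm a b (D1 : 'M[C]_a) (D2 : 'M[C]_b) (Y : 'M[C]_(a, b)) :
  D1^h = D1 -> D2^h = D2 -> (block_mx D1 Y Y^h D2)^h = block_mx D1 Y Y^h D2.
Proof. by move=> h1 h2; rewrite ctmx_block h1 h2 ctmxK. Qed.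

(** The positive frames of the two blocks are kept and made mutually orthogonal, and j further
    vectors from each side are added in pairs. With j the smaller of a - ipos D1 and b - ipos D2,
    the total ipos D1 + ipos D2 + j is the bound. *)
Lemma completion_max a b (D1 : 'M[C]_a) (D2 : 'M[C]_b) : D1^h = D1 -> D2^h = D2 ->
  exists Y : 'M[C]_(a, b),
    (minn (ipos D1 + b) (ipos D2 + a) <= ipos (block_mx D1 Y Y^h D2))%N.
Proof.
move=> h1 h2; have le1 := ipos_leq h1; have le2 := ipos_leq h2.
set j := minn (a - ipos D1) (b - ipos D2).
have [|P1 [R1 [PP1 RP1 /row_freeP[M1 E1]]]] := @frame_extend _ j _ h1; first by lia.
have [|P2 [R2 [PP2 RP2 /row_freeP[M2 E2]]]] := @frame_extend _ j _ h2; first by lia.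
have [d1 Ed1] : exists d, d = R1 *m D1 *m R1^h by eexists.
have hd1 : d1^h = d1 by rewrite Ed1 ctmx_congr.
have [d2 Ed2] : exists d, d = R2 *m D2 *m R2^h by eexists.
have hd2 : d2^h = d2 by rewrite Ed2 ctmx_congr.
(* The Gram matrix of the sums of paired rows of [R1] and [R2] is d1 + d2 + K + K^h, which must be
   the identity. *)
pose K := 2^-1 *: (1%:M - d1 - d2).
have hK : K^h = K.
  by rewrite ctmxZ !ctmxB ctmx1 hd1 hd2 conj_Creal ?rpredV ?realn.
have KK : K + K = 1%:M - (d1 + d2).
  by rewrite /K -scalerDl -div1r -splitr scale1r opprD addrA.
pose Y := M1 *m block_mx 0 0 0 K *m M2^h.
have : col_mx P1 R1 *m Y *m (col_mx P2 R2)^h = block_mx 0 0 0 K.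
  by rewrite /Y !mulmxA E1 mul1mx -mulmxA -ctmxM E2 ctmx1 mulmx1.
rewrite ctmx_col mul_col_mx mul_col_row => /eq_block_mx[PYP PYR RYP RYR].
have PR1 : P1 *m D1 *m R1^h = 0 by apply: ctmx_inj; rewrite !ctmxM ctmxK h1 mulmxA RP1 ctmx0.
have PR2 : P2 *m D2 *m R2^h = 0 by apply: ctmx_inj; rewrite !ctmxM ctmxK h2 mulmxA RP2 ctmx0.
have PYR' : P2 *m Y^h *m R1^h = 0.
  by apply: ctmx_inj; rewrite !ctmxM !ctmxK mulmxA RYP ctmx0.
have RYR' : R2 *m Y^h *m R1^h = K.
  by apply: ctmx_inj; rewrite !ctmxM !ctmxK mulmxA RYR hK.
exists Y; set W := block_mx _ _ _ _; have hW : W^h = W by exact: block_herm.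
have : (j + ipos (block_mx P1 0 0 P2 *m W *m (block_mx P1 0 0 P2)^h) <= ipos W)%N.
  apply: (@ipos_ge_frame_orth _ _ _ _ (row_mx R1 R2)) => //.
    rewrite /W mul_row_block ctmx_row mul_row_col !mulmxDl -Ed1 -Ed2 RYR RYR'.
    by rewrite [K + d2]addrC addrACA KK addrC subrK.
  rewrite /W mulmx_block ctmx_row mul_block_col !mul0mx !addr0 !add0r.
  by rewrite PR1 PR2 PYR PYR' !addr0 col_mx0.
have -> : block_mx P1 0 0 P2 *m W *m (block_mx P1 0 0 P2)^h = 1%:M.
  have PYP' : P2 *m Y^h *m P1^h = 0.
    by apply: ctmx_inj; rewrite !ctmxM !ctmxK mulmxA PYP ctmx0.
  rewrite ctmx_block !ctmx0 /W !mulmx_block !(mul0mx, mulmx0, addr0, add0r).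
  by rewrite PP1 PP2 PYP PYP' -scalar_mx_block.
by rewrite ipos1; lia.
Qed.

(** A positive and a negative frame of total size k are stacked. They need not be orthogonal: the
    Gram matrix has indices at least k1 and k2, which already forces full rank. *)
Lemma nondegenerate_rows n k (H : 'M[C]_n) : H^h = H -> (k <= \rank H)%N ->
  exists K : 'M[C]_(k, n), \rank (K *m H *m K^h) = k.
Proof.
move=> hH; rewrite mxrank_herm // => lek.
have hN : (- H)^h = - H by rewrite ctmxN hH.
have [k1 [k2 [-> le1 le2]]] :
    exists k1 k2, [/\ k = (k1 + k2)%N, (k1 <= ipos H)%N & (k2 <= ineg H)%N].
  by exists (minn k (ipos H)), (k - minn k (ipos H))%N; split; lia.
rewrite ineg_ipos // in le2.
have [P EP] := ipos_frame hH le1; have [N EN] := ipos_frame hN le2.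
exists (col_mx P N); set W := _ *m _ *m _.
have hW : W^h = W by exact: ctmx_congr.
have EW : W = block_mx (P *m H *m P^h) (P *m H *m N^h) (N *m H *m P^h) (N *m H *m N^h).
  by rewrite /W ctmx_col mul_col_mx mul_col_row.
apply/eqP; rewrite eqn_leq rank_leq_row mxrank_herm // leq_add //.
  rewrite -{1}(ipos1 k1) -EP.
  have -> : P *m H *m P^h = row_mx 1%:M 0 *m W *m (row_mx 1%:M 0)^h.
    rewrite EW mul_row_block ctmx_row mul_row_col !ctmx0 ctmx1.
    by rewrite !(mul1mx, mul0mx, mulmx1, mulmx0, addr0).
  exact: ipos_congr_le.
rewrite ineg_ipos // -{1}(ipos1 k2) -EN.
have -> : N *m - H *m N^h = row_mx 0 1%:M *m - W *m (row_mx 0 1%:M)^h.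
  rewrite EW mulmxN mulNmx mulmxN mulNmx mul_row_block ctmx_row mul_row_col.
  by rewrite !ctmx0 ctmx1 !(mul1mx, mul0mx, mulmx1, mulmx0, add0r).
by apply: ipos_congr_le; rewrite ctmxN hW.
Qed.

(** The hypothesis says that [D1] has the larger nullity; then b <= a + rank D2, so the bound rank
    D2 + 2a is never below a + b and may be dropped. Each of j kernel vectors of [D1] is paired with
    the other side into a hyperbolic plane, leaving [D1] and b - j nondegenerate rows of [D2]: in
    all 2j + rank D1 + (b - j). *)
Lemma completion_rank_aux a b (D1 : 'M[C]_a) (D2 : 'M[C]_b) :
  D1^h = D1 -> D2^h = D2 -> (a + \rank D2 >= b + \rank D1)%N ->
  exists Y : 'M[C]_(a, b),
    (minn (a + b) (\rank D1 + b.*2) <= \rank (block_mx D1 Y Y^h D2))%N.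
Proof.
move=> h1 h2 le12; set j := minn (a - \rank D1) b.
have lej : (j <= \rank (kermx D1))%N by rewrite mxrank_ker; lia.
have [R1 fR1 /sub_kermxP RD] := row_free_sub lej.
have lek : (b - j <= \rank D2)%N by have := rank_leq_row D2; lia.
have [K rK] := nondegenerate_rows h2 lek.
have rK' : \rank K^h = (b - j)%N.
  by apply/eqP; rewrite eqn_leq rank_leq_col -{1}rK mxrankM_maxr.
have lejV : (j <= \rank (kermx K^h))%N by rewrite mxrank_ker rK'; lia.
(* [V] annihilates [K^h], so the kernel vectors [R1] pair to zero with the retained rows [K]; the
   right inverse [V'] supplies their hyperbolic partners. *)
have [V /row_freeP[V' EV] /sub_kermxP VK] := row_free_sub lejV.
set Q1 := row_base (R1^C)%MS.
have fS : row_free (col_mx Q1 R1).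
  rewrite /row_free -addsmxE mxrank_disjoint_sum ?eq_row_base ?(eqP fR1) //.
  apply/eqP; rewrite -submx0.
  by rewrite (cap_eqmx (eq_row_base _) (eqmx_refl R1)) capmxC capmx_compl.
have uS : row_full (col_mx Q1 R1).
  rewrite /row_full -addsmxE (adds_eqmx (eq_row_base _) (eqmx_refl R1)) addsmxC.
  exact: addsmx_compl_full.
have /row_freeP[M EM] := fS.
pose Y := M *m col_mx 0 V.
have /eq_col_mx[QY RY] : col_mx (Q1 *m Y) (R1 *m Y) = col_mx 0 V.
  by rewrite -mul_col_mx /Y mulmxA EM mul1mx.
exists Y; set W := block_mx _ _ _ _; have hW : W^h = W by exact: block_herm.
pose R := block_mx Q1 0 0 K.
have DR : D1 *m R1^h = 0 by apply: ctmx_inj; rewrite ctmxM ctmxK h1 RD ctmx0.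
have KV : K *m V^h = 0 by apply: ctmx_inj; rewrite ctmxM ctmxK VK ctmx0.
have ERW : R *m W *m R^h = block_mx (Q1 *m D1 *m Q1^h) 0 0 (K *m D2 *m K^h).
  have YQ : Y^h *m Q1^h = 0 by rewrite -ctmxM QY ctmx0.
  rewrite ctmx_block !ctmx0 /W !mulmx_block !(mul0mx, mulmx0, addr0, add0r).
  by rewrite QY -(mulmxA _ Y^h) YQ mul0mx mulmx0.
have xx : row_mx R1 0 *m W *m (row_mx R1 0)^h = 0.
  rewrite /W mul_row_block ctmx_row mul_row_col !mul0mx !addr0 ctmx0 mulmx0.
  by rewrite RD mul0mx addr0.
have xy : row_mx R1 0 *m W *m (row_mx 0 V'^h)^h = 1%:M.
  rewrite /W mul_row_block ctmx_row mul_row_col !mul0mx !addr0 ctmx0 mulmx0.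
  by rewrite ctmxK add0r RY EV.
have Rx : R *m W *m (row_mx R1 0)^h = 0.
  rewrite /W mulmx_block ctmx_row mul_block_col !mul0mx !addr0 !add0r ctmx0 !mulmx0.
  by rewrite !addr0 -!mulmxA DR !mulmx0 -ctmxM RY KV col_mx0.
have := ipos_ge_isotropic hW xx xy Rx; have := ineg_ge_isotropic hW xx xy Rx.
have := mxrank_herm (ctmx_congr R hW); rewrite {1}ERW rank_diag_block_mx rK.
have -> : \rank (Q1 *m D1 *m Q1^h) = \rank D1.
  have E : col_mx Q1 R1 *m D1 *m (col_mx Q1 R1)^h = block_mx (Q1 *m D1 *m Q1^h) 0 0 0.
    rewrite ctmx_col mul_col_mx mul_col_row RD !mul0mx.
    by rewrite -(mulmxA Q1 D1 R1^h) DR mulmx0.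
  have : \rank (col_mx Q1 R1 *m D1 *m (col_mx Q1 R1)^h) = \rank D1.
    rewrite mxrankMfree ?row_free_ctmx // -mxrank_ctmx ctmxM.
    by rewrite mxrankMfree ?row_free_ctmx // mxrank_ctmx.
  by rewrite E rank_diag_block_mx mxrank0 addn0.
rewrite (mxrank_herm hW) -addnn; lia.
Qed.

Lemma completion_rank a b (D1 : 'M[C]_a) (D2 : 'M[C]_b) :
  D1^h = D1 -> D2^h = D2 -> exists Y : 'M[C]_(a, b),
    (minn (a + b) (minn (\rank D1 + b.*2) (\rank D2 + a.*2)) <=
      \rank (block_mx D1 Y Y^h D2))%N.
Proof.
move=> h1 h2; have [le12|lt12] := leqP (b + \rank D1) (a + \rank D2).
  have [Y EY] := completion_rank_aux h1 h2 le12; exists Y; lia.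
have [Y EY] := completion_rank_aux h2 h1 (ltnW lt12); exists Y^h.
rewrite ctmxK.
suff: (\rank (block_mx D2 Y Y^h D1) <= \rank (block_mx D1 Y^h Y D2))%N by lia.
have <- : block_mx 0 1%:M 1%:M 0 *m block_mx D1 Y^h Y D2 *m
    block_mx 0 1%:M 1%:M 0 = block_mx D2 Y Y^h D1.
  by rewrite !mulmx_block !(mul0mx, mulmx0, addr0, add0r, mul1mx, mulmx1).
by rewrite (leq_trans (mxrankM_maxl _ _)) // mxrankM_maxr.
Qed.

End Completion.

(** * The case where the common kernel lies in the radical *)

Section Terminal.
Variable C : numClosedFieldType.
Implicit Types a b c k l m n p : nat.

Definition linform n p m (H : 'M[C]_n) (E : 'M[C]_(n, p)) (F : 'M[C]_(n, m))
    (X : 'M[C]_(p, m)) := H + (E *m X *m F^h + (E *m X *m F^h)^h).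

Lemma linform_herm n p m (H : 'M[C]_n) (E : 'M[C]_(n, p)) (F : 'M[C]_(n, m)) X :
  H^h = H -> (linform H E F X)^h = linform H E F X.
Proof. by move=> hH; rewrite /linform !ctmxD ctmxK hH [X in _ + X]addrC. Qed.

Lemma linform_congr k n p m (S : 'M[C]_(k, n)) (H : 'M[C]_n) (E : 'M[C]_(n, p))
    (F : 'M[C]_(n, m)) X :
  S *m linform H E F X *m S^h = linform (S *m H *m S^h) (S *m E) (S *m F) X.
Proof.
rewrite /linform !mulmxDr !mulmxDl; congr (_ + (_ + _)).
  by rewrite ctmxM !mulmxA.
by rewrite !ctmxM !ctmxK !mulmxA.
Qed.

Lemma inertia_block0 k n (H : 'M[C]_n) : H^h = H ->
  ipos (block_mx H 0 0 (0 : 'M_k)) = ipos H /\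
  ineg (block_mx H 0 0 (0 : 'M_k)) = ineg H.
Proof.
move=> hH; set B := block_mx _ _ _ _.
have hB : B^h = B by rewrite ctmx_block hH !ctmx0.
have E1 : H = row_mx 1%:M 0 *m B *m (row_mx 1%:M 0)^h.
  rewrite mul_row_block ctmx_row mul_row_col ctmx1 ctmx0.
  by rewrite !(mul1mx, mul0mx, mulmx1, mulmx0, addr0).
have E2 : B = col_mx 1%:M 0 *m H *m (col_mx 1%:M 0)^h.
  rewrite ctmx_col mul_col_mx mul_col_row ctmx1 ctmx0.
  by rewrite !(mul1mx, mul0mx, mulmx1, mulmx0).
split; apply/eqP; rewrite eqn_leq.
  by rewrite {1}E2 ipos_congr_le //= {1}E1 ipos_congr_le.
by rewrite {1}E2 ineg_congr_le //= {1}E1 ineg_congr_le.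
Qed.

(* With K0 = ker E ∩ ker F, K1 = ker E = K0 + L1, K2 = ker F = K0 + L2, and M a
   complement of K1 + K2; T is dual to the basis [L1; L2; M] modulo K0. *)
Lemma adapted_basis n p m (E : 'M[C]_(n, p)) (F : 'M[C]_(n, m)) :
  let G := row_mx F E in
  exists a b c (L1 : 'M[C]_(a, n)) (L2 : 'M[C]_(b, n)) (M : 'M[C]_(c, n))
    (T : 'M[C]_(n, a + (b + c))),
  let S := col_mx L1 (col_mx L2 M) in
  [/\ [/\ (b + c)%N = \rank E, (a + c)%N = \rank F & (a + (b + c))%N = \rank G],
      S *m T = 1%:M /\ (forall k (A : 'M[C]_(n, k)), kermx G *m A = 0 -> A = T *m S *m A),
      L1 *m E = 0 /\ L2 *m F = 0,
      (kermx E <= kermx G + L1)%MS & (kermx F <= kermx G + L2)%MS].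
Proof.
move=> G; set K1 := kermx E; set K2 := kermx F.
have EK : (K1 :&: K2 :=: kermx G)%MS.
  apply/eqmxP/andP; split.
    apply/sub_kermxP; rewrite /G mul_mx_row.
    have /sub_kermxP -> : (K1 :&: K2 <= kermx F)%MS by exact: capmxSr.
    have /sub_kermxP -> : (K1 :&: K2 <= kermx E)%MS by exact: capmxSl.
    by rewrite row_mx0.
  have := mulmx_ker G; rewrite {2}/G mul_mx_row -[0]row_mx0 => /eq_row_mx[h1 h2].
  by rewrite sub_capmx; apply/andP; split; apply/sub_kermxP.
set K0 := row_base (kermx G).
set L1 := row_base (K1 :\: K2)%MS; set L2 := row_base (K2 :\: K1)%MS.
set M := row_base (K1 + K2)^C%MS.
have rK0 : \rank (kermx G) = (n - \rank G)%N by rewrite mxrank_ker.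
have ra := mxrank_cap_compl K1 K2; have rb := mxrank_cap_compl K2 K1.
have rc := mxrank_compl (K1 + K2)%MS; have rs := mxrank_sum_cap K1 K2.
rewrite capmxC in rb.
rewrite EK rK0 !mxrank_ker in ra rb rc rs.
have rE := rank_leq_row E; have rF := rank_leq_row F; have rG := rank_leq_row G.
have rS := rank_leq_col (K1 + K2)%MS.
pose B := col_mx K0 (col_mx L1 (col_mx L2 M)).
have E1 : (kermx G + L1 :=: K1)%MS.
  apply: eqmx_trans (adds_eqmx (eqmx_sym EK) (eq_row_base _)) _.
  by rewrite addsmxC; exact: addsmx_diff_cap_eq.
have E2 : (kermx G + L2 :=: K2)%MS.
  apply: eqmx_trans (adds_eqmx (eqmx_sym EK) (eq_row_base _)) _.
  by rewrite capmxC addsmxC; exact: addsmx_diff_cap_eq.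
have fullB : row_full B.
  rewrite -sub1mx; apply: submx_trans (_ : 1%:M <= (K1 + K2) + (K1 + K2)^C)%MS _.
    by rewrite sub1mx addsmx_compl_full.
  have sK0 : (kermx G <= B)%MS by rewrite -(eq_row_base (kermx G)) -addsmxE addsmxSl.
  have sL1 : (L1 <= B)%MS by rewrite -addsmxE (submx_trans _ (addsmxSr _ _)) // -addsmxE addsmxSl.
  have sL2 : (L2 <= B)%MS.
    rewrite -addsmxE (submx_trans _ (addsmxSr _ _)) // -addsmxE.
    by rewrite (submx_trans _ (addsmxSr _ _)) // -addsmxE addsmxSl.
  have sM : (M <= B)%MS.
    rewrite -addsmxE (submx_trans _ (addsmxSr _ _)) // -addsmxE.
    by rewrite (submx_trans _ (addsmxSr _ _)) // -addsmxE addsmxSr.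
  rewrite !addsmx_sub -E1 -E2 !addsmx_sub sK0 sL1 sL2 /=.
  by move: sM; rewrite eq_row_base.
have freeB : row_free B.
  by rewrite /row_free (eqP fullB); apply/eqP; rewrite rK0; lia.
(* The number of rows of [B] equals n only propositionally, so [pinvmx] serves as a two-sided
   inverse without casts. *)
have BT := mulmxVp freeB; have TB := mulVpmx fullB.
set BV := pinvmx B in BT TB.
exists _, _, _, L1, L2, M, (rsubmx BV); split.
- by split; lia.
- split=> [|k A KA].
    have := BT; rewrite -{1}[BV]hsubmxK mul_col_row scalar_mx_block.
    by move=> /eq_block_mx[].
  have K0A : K0 *m A = 0.
    have /submxP[u ->] : (K0 <= kermx G)%MS by rewrite eq_row_base.
    by rewrite -mulmxA KA mulmx0.
  have TB' : lsubmx BV *m K0 + rsubmx BV *m col_mx L1 (col_mx L2 M) = 1%:M.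
    by rewrite -mul_row_col hsubmxK.
  by rewrite -{1}[A]mul1mx -TB' mulmxDl -(mulmxA _ K0 A) K0A mulmx0 add0r.
- by split; apply/sub_kermxP; rewrite eq_row_base diffmxSl.
- by rewrite E1.
- by rewrite E2.
Qed.

(** [E X F^h] vanishes on rows [L1] and on columns [L2], so [D1] and [D2] are fixed. The remaining
    block of rows [L2], [M] and columns [L1], [M] can be prescribed at will through right inverses
    of the two row-free factors. *)
Lemma linform_complete n p m a b c (H : 'M[C]_n) (E : 'M[C]_(n, p))
    (F : 'M[C]_(n, m)) (L1 : 'M[C]_(a, n)) (L2 : 'M[C]_(b, n)) (M : 'M[C]_(c, n))
    (Y1 : 'M[C]_(a, b)) (Y2 : 'M[C]_(a, c)) (V : 'M[C]_(b, c)) (Z : 'M[C]_c) :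
  H^h = H -> Z^h = Z -> L1 *m E = 0 -> L2 *m F = 0 ->
  row_free (col_mx L2 M *m E) -> row_free (col_mx L1 M *m F) ->
  let S := col_mx L1 (col_mx L2 M) in
  exists X : 'M[C]_(p, m), S *m linform H E F X *m S^h =
    block_mx (L1 *m H *m L1^h) (row_mx Y1 Y2) (row_mx Y1 Y2)^h
             (block_mx (L2 *m H *m L2^h) V V^h Z).
Proof.
move=> hH hZ LE LF /row_freeP[JE EJ] /row_freeP[JF FJ] S.
(* The corner [M], [M] receives the new block and its conjugate transpose, hence the half; every
   other free entry receives only one of the two. *)
pose Z0 := 2^-1 *: (Z - M *m H *m M^h).
pose Q := block_mx (Y1 - L1 *m H *m L2^h)^h (V - L2 *m H *m M^h)
                   (Y2 - L1 *m H *m M^h)^h Z0.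
exists (JE *m Q *m JF^h); set X := JE *m _ *m _.
have [K EK] : exists K, K = E *m X *m F^h by eexists.
have EQ : col_mx L2 M *m K *m (col_mx L1 M)^h = Q.
  have -> : col_mx L2 M *m K *m (col_mx L1 M)^h =
    (col_mx L2 M *m E) *m X *m (col_mx L1 M *m F)^h.
    by rewrite EK [(_ *m F)^h]ctmxM !mulmxA.
  rewrite /X !mulmxA EJ mul1mx -mulmxA -ctmxM FJ.
  by rewrite ctmx1 mulmx1.
move: EQ; rewrite ctmx_col mul_col_mx mul_col_row.
move=> /eq_block_mx[K21 K23 K31 K33].
have K1 : L1 *m K = 0 by rewrite EK !mulmxA LE !mul0mx.
have K2 : K *m L2^h = 0 by rewrite EK -mulmxA -ctmxM LF ctmx0 mulmx0.
have form k l (u : 'M_(k, n)) (v : 'M_(l, n)) :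
  u *m linform H E F X *m v^h = u *m H *m v^h + (u *m K *m v^h + (v *m K *m u^h)^h).
  rewrite /linform -EK !mulmxDr !mulmxDl; congr (_ + (_ + _)).
  by rewrite !ctmxM ctmxK mulmxA.
have hMM : (M *m H *m M^h)^h = M *m H *m M^h by exact: ctmx_congr.
have hZ0 : Z0^h = Z0 by rewrite ctmxZ ctmxB hZ hMM conj_Creal ?rpredV ?realn.
have K2' k (u : 'M_(k, n)) : u *m K *m L2^h = 0 by rewrite -mulmxA K2 mulmx0.
rewrite /S !ctmx_col ctmx_row mul_col_mx mul_col_row.
rewrite [L1 *m _ *m row_mx _ _]mul_mx_row mul_col_mx mul_col_row mul_col_mx.
rewrite !form K1 !K2' !mul0mx K21 K23 K31 K33 !ctmxK !ctmx0 !(addr0, add0r).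
have swap k l (u : 'M_(k, n)) (v : 'M_(l, n)) : (u *m H *m v^h)^h = v *m H *m u^h.
  by rewrite !ctmxM ctmxK hH mulmxA.
rewrite !ctmxB !swap hZ0 -scalerDl -div1r -splitr scale1r.
by rewrite ![_ + (_ - _)]addrC !subrK.
Qed.

(** From below, rank E hyperbolic planes are built from border vectors. From above, the form is
    restricted to ker E together with the border, a subspace of codimension rank E where only
    [L H L^h] survives. *)
Lemma inertia_bordered n p k l (H : 'M[C]_n) (E : 'M[C]_(n, p))
    (K : 'M[C]_(k, n)) (L : 'M[C]_(l, n)) :
  H^h = H -> K *m H = 0 -> L *m E = 0 -> (kermx E <= K + L)%MS ->
  ipos (bordered H E E^h) = (ipos (L *m H *m L^h) + \rank E)%N /\
  ineg (bordered H E E^h) = (ineg (L *m H *m L^h) + \rank E)%N.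
Proof.
move=> hH KH LE /sub_addsmxP[[u v] /= EK].
set B := bordered H E E^h; have hB : B^h = B by exact: bordered_herm.
have HK : H *m K^h = 0 by apply: ctmx_inj; rewrite ctmxM ctmxK hH KH ctmx0.
(* The columns of [E] may be dependent: [J] selects rank E border vectors, and [y0] provides vectors
   pairing with them to the identity. *)
have [J EJ] := row_freeP (row_base_free E).
have yE : pinvmx (col_base E) *m E = row_base E.
  by rewrite -[X in _ *m X = _]mulmx_base mulmxA mulVpmx ?mul1mx // col_base_full.
set y0 := pinvmx (col_base E) in yE.
have xx : row_mx 0 J^h *m B *m (row_mx 0 J^h)^h = 0.
  rewrite /B /bordered mul_row_block ctmx_row mul_row_col ctmx0 mulmx0.
  by rewrite !(mulmx0, mul0mx, addr0).
have xy : row_mx 0 J^h *m B *m (row_mx y0 0)^h = 1%:M.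
  rewrite /B /bordered mul_row_block ctmx_row mul_row_col ctmx0 !mulmx0.
  by rewrite mul0mx add0r addr0 -!ctmxM mulmxA yE EJ ctmx1.
have Rx : row_mx L 0 *m B *m (row_mx 0 J^h)^h = 0.
  rewrite /B /bordered mul_row_block ctmx_row mul_row_col LE ctmx0.
  by rewrite !(mulmx0, mul0mx, addr0).
have ER : row_mx L 0 *m B *m (row_mx L 0)^h = L *m H *m L^h.
  rewrite /B /bordered mul_row_block ctmx_row mul_row_col ctmx0.
  by rewrite !(mulmx0, mul0mx, addr0).
have := ipos_ge_isotropic hB xx xy Rx; have := ineg_ge_isotropic hB xx xy Rx.
rewrite ER => geN geP.
have EP : block_mx (kermx E) 0 0 1%:M *m B *m (block_mx (kermx E) 0 0 1%:M)^h =
    block_mx (kermx E *m H *m (kermx E)^h) 0 0 (0 : 'M_p).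
  have EK0 : E^h *m (kermx E)^h = 0 by rewrite -ctmxM (mulmx_ker E) ctmx0.
  by rewrite ctmx_block !ctmx0 ctmx1 /B bordered_congr EK0 (mulmx_ker E).
have rP : \rank (block_mx (kermx E) 0 0 (1%:M : 'M_p)) = (n - \rank E + p)%N.
  by rewrite rank_diag_block_mx mxrank1 mxrank_ker.
have EKH : kermx E *m H *m (kermx E)^h = v *m (L *m H *m L^h) *m v^h.
  rewrite EK !mulmxDl ctmxD !mulmxDr !ctmxM -!mulmxA !(mulmxA K H) KH.
  by rewrite !(mulmxA H K^h) HK !(mul0mx, mulmx0) !add0r.
have hL : (L *m H *m L^h)^h = L *m H *m L^h by exact: ctmx_congr.
have := ipos_restrict (block_mx (kermx E) 0 0 1%:M) hB.
have := ineg_restrict (block_mx (kermx E) 0 0 1%:M) hB.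
have [i1 i2] := inertia_block0 p (ctmx_congr (kermx E) hH).
have := ipos_congr_le v hL; have := ineg_congr_le v hL.
rewrite EP rP i1 i2 EKH; have := rank_leq_row E.
move: geN geP; move: (ipos (L *m _ *m _)) (ineg (L *m _ *m _)) (ipos B) (ineg B).
by move: (ipos (v *m _ *m _)) (ineg (v *m _ *m _)); lia.
Qed.

Lemma mxrank_row_ker n k l (H : 'M[C]_(n, k)) (G : 'M[C]_(n, l)) :
  kermx G *m H = 0 -> \rank (row_mx H G) = \rank G.
Proof.
move=> KH; have /mxrankS : (kermx G <= kermx (row_mx H G))%MS.
  by apply/sub_kermxP; rewrite mul_mx_row KH mulmx_ker row_mx0.
rewrite !mxrank_ker; have := rank_leq_row (row_mx H G).
have : (\rank G <= \rank (row_mx H G))%N.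
  have EG : G = row_mx H G *m col_mx 0 1%:M.
    by rewrite mul_row_col mulmx0 mulmx1 add0r.
  by rewrite {1}EG mxrankM_maxl.
have := rank_leq_row G; lia.
Qed.

(** The kernel condition puts the columns of [H] in the column space of [G], so a column operation
    clears [H]. *)
Lemma mxrank_bordered_ker n k l (H : 'M[C]_n) (G : 'M[C]_(n, k)) (V : 'M[C]_(l, n)) :
  kermx G *m H = 0 -> \rank (bordered H G V) = (\rank G + \rank V)%N.
Proof.
move=> KH; apply/eqP; rewrite eqn_leq; apply/andP; split.
  rewrite /bordered /block_mx -addsmxE.
  apply: leq_trans (mxrank_adds_leqif _ _) _.
  by rewrite (mxrank_row_ker KH) rank_row_mx0.
have [J ->] : exists J, H = G *m J.
  suff /submxP[D ED] : (H^T <= G^T)%MS.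
    by exists D^T; rewrite -[LHS]trmxK ED trmx_mul trmxK.
  have rHG : \rank (col_mx H^T G^T) = \rank G^T.
    by rewrite -tr_row_mx !mxrank_tr mxrank_row_ker.
  have sG : (G^T <= col_mx H^T G^T)%MS by rewrite -addsmxE addsmxSr.
  have sH : (H^T <= col_mx H^T G^T)%MS by rewrite -addsmxE addsmxSl.
  by apply: submx_trans sH _; rewrite -(geq_leqif (mxrank_leqif_sup sG)) rHG.
have E : bordered (G *m J) G V *m block_mx 0 1%:M 1%:M (- J) = block_mx G 0 0 V.
  rewrite /bordered mulmx_block !mulmx1 !mulmx0 mul0mx mulmxN subrr.
  by rewrite !add0r addr0.
by rewrite -rank_diag_block_mx -E mxrankM_maxl.
Qed.

(** All the assertions of the theorem in additive form over nat, away from truncated subtraction: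
    upper bounds, lower bounds, their attainment, and maximal rank. The third clause asks one [x] to
    minimize both indices, which yields the minimal rank; the fourth allows different maximizers. A
    disjunction replaces deciding which of two bounds is active. *)
Definition extremal (X : Type) (lp ln : X -> nat) (r0 r2 r4 ap an bp bn : nat) :=
  [/\ forall x, [/\ (lp x <= ap)%N, (ln x <= an)%N, (lp x <= bp)%N, (ln x <= bn)%N
                  & (lp x + ln x <= r0)%N],
      forall x, [/\ (r0 + ap <= lp x + r2)%N, (r0 + an <= ln x + r2)%N,
                    (r0 + bp <= lp x + r4)%N & (r0 + bn <= ln x + r4)%N],
      exists x,
        ((lp x + r2 <= r0 + ap)%N \/ (lp x + r4 <= r0 + bp)%N) /\
        ((ln x + r2 <= r0 + an)%N \/ (ln x + r4 <= r0 + bn)%N),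
      (exists x, (ap <= lp x)%N \/ (bp <= lp x)%N) /\
      (exists x, (an <= ln x)%N \/ (bn <= ln x)%N)
    & exists x, (r0 <= lp x + ln x)%N \/ (ap + an <= lp x + ln x)%N
                  \/ (bp + bn <= lp x + ln x)%N].

(** Each L(X) is a compression of the same bordered matrix, by the row block [1, F X^h]. *)
Lemma linform_upper n p m (H : 'M[C]_n) (E : 'M[C]_(n, p)) (F : 'M[C]_(n, m)) X :
  H^h = H ->
  (ipos (linform H E F X) <= ipos (bordered H E E^h))%N /\
  (ineg (linform H E F X) <= ineg (bordered H E E^h))%N.
Proof.
move=> hH; have hB := bordered_herm E hH.
have -> : linform H E F X =
    row_mx 1%:M (F *m X^h) *m bordered H E E^h *m (row_mx 1%:M (F *m X^h))^h.
  rewrite /bordered mul_row_block ctmx_row mul_row_col ctmx1 mulmx1 !mul1mx.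
  by rewrite mulmx0 addr0 /linform !ctmxM !ctmxK !mulmxA -addrA [X in _ + X]addrC.
by split; [exact: ipos_congr_le | exact: ineg_congr_le].
Qed.

Lemma linform_swap n p m (H : 'M[C]_n) (E : 'M[C]_(n, p)) (F : 'M[C]_(n, m)) X :
  linform H E F X = linform H F E X^h.
Proof.
by rewrite /linform; congr (_ + _); rewrite addrC !ctmxM !ctmxK !mulmxA.
Qed.

Lemma linform_restrict n p m k (H : 'M[C]_n) (E : 'M[C]_(n, p)) (F : 'M[C]_(n, m))
    (L : 'M[C]_(k, n)) X :
  H^h = H -> L *m E = 0 ->
  (ipos (L *m H *m L^h) <= ipos (linform H E F X))%N /\
  (ineg (L *m H *m L^h) <= ineg (linform H E F X))%N.
Proof.
move=> hH LE; have hL := linform_herm E F X hH.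
have -> : L *m H *m L^h = L *m linform H E F X *m L^h.
  by rewrite linform_congr LE /linform !mul0mx ctmx0 !addr0.
by split; [exact: ipos_congr_le | exact: ineg_congr_le].
Qed.

Lemma block1_ge k n (D : 'M[C]_n) : D^h = D ->
  (k + ipos D <= ipos (block_mx D 0 0 (1%:M : 'M_k)))%N.
Proof.
move=> hD; set B := block_mx _ _ _ _.
have hB : B^h = B by rewrite ctmx_block hD ctmx1 !ctmx0.
have -> : D = row_mx 1%:M 0 *m B *m (row_mx 1%:M 0)^h.
  rewrite mul_row_block ctmx_row mul_row_col ctmx1 ctmx0.
  by rewrite !(mul1mx, mul0mx, mulmx1, mulmx0, addr0).
apply: (@ipos_ge_frame_orth _ _ _ _ (row_mx 0 1%:M)) => //.
  rewrite mul_row_block ctmx_row mul_row_col ctmx1 ctmx0.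
  by rewrite !(mul1mx, mul0mx, mulmx1, mulmx0, addr0, add0r).
rewrite mul_row_block ctmx_row mul_row_col ctmx1 ctmx0.
by rewrite !(mul1mx, mul0mx, mulmx1, mulmx0, addr0, add0r).
Qed.

(** Upper bounds come from bordering, lower bounds from compressing to ker E and ker F, where [X] is
    invisible. For attainment the corner on [M] is filled first, extending [D2], and the result is
    then completed against [D1]. *)
Lemma terminal_extremal n p m (H : 'M[C]_n) (E : 'M[C]_(n, p)) (F : 'M[C]_(n, m)) :
  H^h = H -> let G := row_mx F E in kermx G *m H = 0 ->
  extremal (fun X => ipos (linform H E F X)) (fun X => ineg (linform H E F X))
    (\rank (row_mx H G)) (\rank (bordered H G E^h)) (\rank (bordered H G F^h))
    (ipos (bordered H E E^h)) (ineg (bordered H E E^h))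
    (ipos (bordered H F F^h)) (ineg (bordered H F F^h)).
Proof.
move=> hH G KH; rewrite !mxrank_bordered_ker // mxrank_row_ker // !mxrank_ctmx.
have := adapted_basis E F; rewrite -/G.
move=> [a [b [c [L1 [L2 [M [T [[de df dg] [ST TS] [LE LF] sE sF]]]]]]]].
set S := col_mx L1 _ in ST TS.
have [ap an] := inertia_bordered hH KH LE sE.
have [bp bn] := inertia_bordered hH KH LF sF.
have up X := linform_upper E F X hH.
have up' X : (ipos (linform H E F X) <= ipos (bordered H F F^h))%N /\
             (ineg (linform H E F X) <= ineg (bordered H F F^h))%N.
  by rewrite linform_swap; exact: linform_upper.
have lo X := linform_restrict F X hH LE.
have lo' X : (ipos (L2 *m H *m L2^h) <= ipos (linform H E F X))%N /\
             (ineg (L2 *m H *m L2^h) <= ineg (linform H E F X))%N.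
  by rewrite linform_swap; exact: linform_restrict.
have := mulmx_ker G; rewrite {2}/G mul_mx_row -[0]row_mx0 => /eq_row_mx[KF KE].
have KX X : kermx G *m linform H E F X = 0.
  rewrite /linform !mulmxDr KH !ctmxM ctmxK !mulmxA KE KF.
  by rewrite !mul0mx !addr0.
have EX X : linform H E F X = T *m (S *m linform H E F X *m S^h) *m T^h.
  have E1 := TS _ _ (KX X).
  have E2 : linform H E F X = linform H E F X *m (T *m S)^h.
    by apply: ctmx_inj; rewrite [RHS]ctmxM ctmxK linform_herm.
  by rewrite {1}E2 {1}E1 ctmxM !mulmxA.
have rX X : (ipos (linform H E F X) + ineg (linform H E F X) <= \rank G)%N.
  rewrite -mxrank_herm ?linform_herm // EX -dg.
  by rewrite (leq_trans (mxrankM_maxl _ _)) // (leq_trans (mxrankM_maxr _ _)) // rank_leq_row.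
have fE : row_free (col_mx L2 M *m E).
  have := TS _ _ KE; rewrite -mulmxA /S mul_col_mx LE => E1.
  rewrite /row_free eqn_leq rank_leq_row (leq_trans (eq_leq de)) // {1}E1.
  by rewrite (leq_trans (mxrankM_maxr _ _)) // rank_col_0mx.
have fF : row_free (col_mx L1 M *m F).
  have := TS _ _ KF; rewrite -mulmxA /S !mul_col_mx LF => E1.
  rewrite /row_free eqn_leq rank_leq_row (leq_trans (eq_leq df)) // {1}E1.
  rewrite (leq_trans (mxrankM_maxr _ _)) // -!addsmxE.
  apply: mxrankS; rewrite addsmx_sub addsmxSl /=.
  apply: submx_trans (addsmxSr _ _); rewrite -addsmxE addsmx_sub sub0mx /=.
  exact: submx_refl.
pose D1 := L1 *m H *m L1^h; pose D2 := L2 *m H *m L2^h.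
have hD1 : D1^h = D1 by exact: ctmx_congr.
have hD2 : D2^h = D2 by exact: ctmx_congr.
(* Congruence by [S] and back by [T] preserves inertia although [S] need not be square: L(X)
   vanishes on [kermx G]. *)
have realize (Y : 'M_(a, b + c)) V Z : Z^h = Z ->
    let W := block_mx D1 Y Y^h (block_mx D2 V V^h Z) in
    exists X, ipos (linform H E F X) = ipos W /\ ineg (linform H E F X) = ineg W.
  move=> hZ W.
  have hW : W^h = W by rewrite block_herm // block_herm.
  have [X] := linform_complete (lsubmx Y) (rsubmx Y) V hH hZ LE LF fE fF.
  rewrite hsubmxK -/S -/D1 -/D2 -/W => EW; exists X.
  have := EX X; rewrite EW => EXW.
  have hX := linform_herm E F X hH.
  split; apply/eqP; rewrite eqn_leq.
    by rewrite {1}EXW ipos_congr_le //= -EW ipos_congr_le.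
  by rewrite {1}EXW ineg_congr_le //= -EW ineg_congr_le.
rewrite ap an bp bn -/D1 -/D2 in up up' lo lo' *.
split.
- move=> X; have [u1 u2] := up X; have [u3 u4] := up' X.
  by split=> //; rewrite -?ap -?an -?bp -?bn.
- move=> X; have [u1 u2] := lo X; have [u3 u4] := lo' X.
  by split; lia.
(* A zero corner adds nothing to either index of [D2]. *)
- have h0 : (block_mx D2 0 0 (0 : 'M_c))^h = block_mx D2 0 0 0.
    by rewrite ctmx_block hD2 !ctmx0.
  have [i1 i2] := inertia_block0 c hD2.
  have [Y [Y1 Y2]] := completion_min hD1 h0.
  have [X [X1 X2]] := realize Y 0 0 (ctmx0 _ _ _).
  rewrite ctmx0 in X1 X2.
  have {}X1 : (ipos (linform H E F X) <= maxn (ipos D1) (ipos D2))%N.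
    by rewrite X1 -i1.
  have {}X2 : (ineg (linform H E F X) <= maxn (ineg D1) (ineg D2))%N.
    by rewrite X2 -i2.
  by exists X; lia.
- split.
    (* An identity corner raises the positive index of the second block by c, which gives the bounds
       ipos D1 + b + c and ipos D2 + c + a. *)
    have h0 : (block_mx D2 0 0 (1%:M : 'M_c))^h = block_mx D2 0 0 1%:M.
      by rewrite ctmx_block hD2 !ctmx0 ctmx1.
    have i1 := block1_ge c hD2.
    have [Y Y1] := completion_max hD1 h0.
    have [X [X1 X2]] := realize Y 0 1%:M (ctmx1 _ _).
    rewrite ctmx0 in X1 X2.
    have {}X1 : (minn (ipos D1 + (b + c)) (c + ipos D2 + a) <= ipos (linform H E F X))%N.
      by rewrite X1 (leq_trans _ Y1) // leq_min !geq_min leqnn leq_add2r i1 orbT.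
    by exists X; lia.
  have hN1 : (- D1)^h = - D1 by rewrite ctmxN hD1.
  have hN2 : (- D2)^h = - D2 by rewrite ctmxN hD2.
  have h0 : (block_mx (- D2) 0 0 (1%:M : 'M_c))^h = block_mx (- D2) 0 0 1%:M.
    by rewrite ctmx_block hN2 !ctmx0 ctmx1.
  have i1 := block1_ge c hN2.
  have [Y Y1] := completion_max hN1 h0.
  have h1 : (- 1%:M : 'M[C]_c)^h = - 1%:M by rewrite ctmxN ctmx1.
  have [X [X1 X2]] := realize (- Y) 0 (- 1%:M) h1.
  have {}X2 : (minn (ineg D1 + (b + c)) (c + ineg D2 + a) <= ineg (linform H E F X))%N.
    rewrite X2 [X in (_ <= X)%N]ineg_ipos; last exact: block_herm hD1 (block_herm _ hD2 h1).
    have -> : - block_mx D1 (- Y) (- Y)^h (block_mx D2 0 0^h (- 1%:M)) =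
        block_mx (- D1) Y Y^h (block_mx (- D2) 0 0 1%:M).
      by rewrite ctmxN ctmx0 !opp_block_mx !oppr0 !opprK.
    rewrite (ineg_ipos hD1) (ineg_ipos hD2); apply: leq_trans Y1.
    by rewrite leq_min !geq_min leqnn leq_add2r i1 orbT.
  by exists X; lia.
(* Two nested completions with an identity corner. Of the resulting bounds, those not listed in the
   goal are at least a + b + c. *)
- have [V V1] := completion_rank hD2 (ctmx1 C c).
  have h0 := block_herm V hD2 (ctmx1 C c).
  have [Y Y1] := completion_rank hD1 h0.
  have [X [X1 X2]] := realize Y V 1%:M (ctmx1 _ _).
  have {X1 X2}EX' : (ipos (linform H E F X) + ineg (linform H E F X))%N =
      \rank (block_mx D1 Y Y^h (block_mx D2 V V^h 1%:M)).
    by rewrite X1 X2 -mxrank_herm; last exact: block_herm hD1 h0.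
  have r1 := mxrank_herm hD1; have r2 := mxrank_herm hD2.
  exists X; move: V1 Y1; rewrite EX' mxrank1 -!addnn.
  by move: (\rank (block_mx D1 _ _ _)) (\rank (block_mx D2 _ _ _)); lia.
Qed.

End Terminal.

(** * From the terminal case to Hermitian linear forms and Schur complements *)

Section Linearization.
Variable C : numClosedFieldType.
Implicit Types n m p q s t k : nat.

(** Both sides of every inequality in [extremal] change by the same amount. This serves twice: for
    the pieces split off from K0 and for the Schur complement. *)
Lemma extremal_shift (X : Type) (kp kn : nat) (lp ln lp' ln' : X -> nat)
    (r0 r2 r4 ap an bp bn r0' r2' r4' ap' an' bp' bn' : nat) :
  (forall x, lp x = (kp + lp' x)%N) -> (forall x, ln x = (kn + ln' x)%N) ->
  r0 = (kp + kn + r0')%N -> r2 = (kp + kn + r2')%N -> r4 = (kp + kn + r4')%N ->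
  ap = (kp + ap')%N -> an = (kn + an')%N -> bp = (kp + bp')%N -> bn = (kn + bn')%N ->
  extremal lp ln r0 r2 r4 ap an bp bn <-> extremal lp' ln' r0' r2' r4' ap' an' bp' bn'.
Proof.
move=> Ep En -> -> -> -> -> -> ->.
split=> - [up lo [x1 H1] [[x2 H2] [x3 H3]] [x4 H4]]; split.
- by move=> x; have := up x; rewrite Ep En => - [*]; split; lia.
- by move=> x; have := lo x; rewrite Ep En => - [*]; split; lia.
- by exists x1; rewrite Ep En in H1; lia.
- by split; [exists x2; rewrite Ep in H2 | exists x3; rewrite En in H3]; lia.
- by exists x4; rewrite Ep En in H4; lia.
- by move=> x; have := up x; rewrite Ep En => - [*]; split; lia.
- by move=> x; have := lo x; rewrite Ep En => - [*]; split; lia.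
- by exists x1; rewrite Ep En; lia.
- by split; [exists x2; rewrite Ep | exists x3; rewrite En]; lia.
- by exists x4; rewrite Ep En; lia.
Qed.

Lemma linform_extremal n p m (H : 'M[C]_n) (E : 'M[C]_(n, p)) (F : 'M[C]_(n, m)) :
  H^h = H -> let G := row_mx F E in
  extremal (fun X => ipos (linform H E F X)) (fun X => ineg (linform H E F X))
    (\rank (row_mx H G)) (\rank (bordered H G E^h)) (\rank (bordered H G F^h))
    (ipos (bordered H E E^h)) (ineg (bordered H E E^h))
    (ipos (bordered H F F^h)) (ineg (bordered H F F^h)).
Proof.
move=> hH G; have [H' [G' [kp [kn [hH' KH' inert rk]]]]] := isotropic_reduction G hH.
pose E' := rsubmx G'; pose F' := lsubmx G'.
have EG' : row_mx F' E' = G' by rewrite hsubmxK.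
have selE (A : 'M[C]_(n, m)) (B : 'M[C]_(n, p)) :
  row_mx A B *m col_mx 0 1%:M = B by rewrite mul_row_col mulmx0 mulmx1 add0r.
have selF (A : 'M[C]_(n, m)) (B : 'M[C]_(n, p)) :
  row_mx A B *m col_mx 1%:M 0 = A by rewrite mul_row_col mulmx0 mulmx1 addr0.
(* The variable part of L(X) is [G Om G^h] for the Hermitian [Om] with off-diagonal blocks [X^h] and
   [X], the form handled by the reduction. *)
have lin (A : 'M[C]_(n, m)) (B : 'M[C]_(n, p)) X K :
  K + row_mx A B *m block_mx 0 X^h X 0 *m (row_mx A B)^h = linform K B A X.
  rewrite mul_row_block !mulmx0 addr0 add0r ctmx_row mul_row_col /linform.
  by rewrite !ctmxM ctmxK mulmxA.
have hOm (X : 'M[C]_(p, m)) : (block_mx 0 X^h X 0)^h = block_mx 0 X^h X 0.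
  by rewrite ctmx_block !ctmx0 ctmxK.
have row0 (K : 'M[C]_n) (A : 'M[C]_(n, m + p)) :
  \rank (bordered K A (0 : 'M_(0, n))) = \rank (row_mx K A).
  by rewrite /bordered /block_mx row_mx0 rank_col_mx0.
have [i1 i2] := inert 0 _ (col_mx 0 1%:M) (ctmx0 _ _ _).
have [i3 i4] := inert 0 _ (col_mx 1%:M 0) (ctmx0 _ _ _).
rewrite !mulmx0 !mul0mx !addr0 -EG' !selE !selF in i1 i2 i3 i4.
have r0 := rk _ 0%N 1%:M 0; have r2 := rk _ _ 1%:M (col_mx 0 1%:M).
have r4 := rk _ _ 1%:M (col_mx 1%:M 0).
rewrite !mulmx1 !mulmx0 ctmx0 !row0 in r0.
rewrite !mulmx1 -EG' !selE in r2; rewrite !mulmx1 -EG' !selF in r4.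
have lE X : ipos (linform H E F X) = (kp + ipos (linform H' E' F' X))%N /\
            ineg (linform H E F X) = (kn + ineg (linform H' E' F' X))%N.
  have := inert _ 0%N 0 (hOm X); rewrite -EG' !lin !mulmx0 ctmx0 /bordered.
  have [-> ->] := inertia_block0 0 (linform_herm E F X hH).
  by have [-> ->] := inertia_block0 0 (linform_herm E' F' X hH').
apply/(extremal_shift (fun X => proj1 (lE X)) (fun X => proj2 (lE X))
  r0 r2 r4 i1 i2 i3 i4).
rewrite -EG'; apply: terminal_extremal => //.
by rewrite EG'.
Qed.

Lemma mxrank_cast m n m' n' (e : (m = m') * (n = n')) (A : 'M[C]_(m, n)) :
  \rank (castmx e A) = \rank A.
Proof. by case: e => e1 e2; case: _ / e1; case: _ / e2. Qed.

Lemma inertia_cast n n' (e : n = n') (A : 'M[C]_n) :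
  ipos (castmx (e, e) A) = ipos A /\ ineg (castmx (e, e) A) = ineg A.
Proof. by case: _ / e. Qed.

Lemma mxrank_schur q n k (U : 'M[C]_(n, q)) (V : 'M[C]_(q, k)) (W : 'M[C]_(n, k)) :
  \rank (block_mx (- 1%:M) V U W) = (q + \rank (W + U *m V)%R)%N.
Proof.
set B := block_mx _ _ _ _.
have EB : block_mx 1%:M 0 U 1%:M *m B *m block_mx 1%:M V 0 1%:M =
    block_mx (- 1%:M) 0 0 (W + U *m V).
  rewrite /B !mulmx_block !(mul1mx, mulmx1, mul0mx, mulmx0, addr0, add0r).
  by rewrite !mulmxN !mulmx1 !mulNmx mul1mx !addNr !mul0mx add0r addrC.
have EB' : block_mx 1%:M 0 (- U) 1%:M *m block_mx (- 1%:M) 0 0 (W + U *m V)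
    *m block_mx 1%:M (- V) 0 1%:M = B.
  rewrite /B !mulmx_block !(mul1mx, mulmx1, mul0mx, mulmx0, addr0, add0r).
  by rewrite !mulmxN !mulmx1 !mulNmx mul1mx !opprK addrC addrK.
have <- : \rank (block_mx (- 1%:M : 'M_q) 0 0 (W + U *m V)%R) = (q + \rank (W + U *m V)%R)%N.
  rewrite rank_diag_block_mx; congr addn.
  by rewrite -scaleN1r mxrank_scale_nz ?mxrank1 // oppr_eq0 oner_eq0.
apply/eqP; rewrite eqn_leq; apply/andP; split.
  by rewrite -EB' (leq_trans (mxrankM_maxl _ _)) // mxrankM_maxr.
by rewrite -EB (leq_trans (mxrankM_maxl _ _)) // mxrankM_maxr.
Qed.

(** Compression by [R] bounds the positive index below, the negative frame [x] orthogonal to [R]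
    bounds the negative one, and the rank identity leaves no slack. *)
Lemma inertia_schur q n (U : 'M[C]_(n, q)) (W : 'M[C]_n) : W^h = W ->
  ipos (block_mx (- 1%:M) U^h U W) = ipos (W + U *m U^h) /\
  ineg (block_mx (- 1%:M) U^h U W) = (q + ineg (W + U *m U^h))%N.
Proof.
move=> hW; set B := block_mx _ _ _ _; set D := W + _.
have hD : D^h = D by rewrite ctmxD hW herm_gram.
have hB : B^h = B by rewrite ctmx_block hW ctmxK ctmxN ctmx1.
pose R := row_mx U 1%:M; pose x : 'M[C]_(q, q + n) := row_mx 1%:M 0.
have RB : R *m B = row_mx 0 D.
  by rewrite mul_row_block mulmxN mulmx1 !mul1mx addNr addrC.
have ER : R *m B *m R^h = D.
  by rewrite RB ctmx_row mul_row_col mul0mx ctmx1 mulmx1 add0r.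
have Rx : R *m B *m x^h = 0.
  by rewrite RB ctmx_row mul_row_col mul0mx ctmx0 mulmx0 addr0.
have xx : x *m B *m x^h = - 1%:M.
  rewrite mul_row_block ctmx_row mul_row_col ctmx0 ctmx1.
  by rewrite !(mul1mx, mulmx1, mul0mx, mulmx0, addr0).
have := ineg_ge_frame_orth hB xx Rx; have := ipos_congr_le R hB.
have := mxrank_herm hB; rewrite mxrank_schur -/D (mxrank_herm hD) ER.
lia.
Qed.

Section BorderedSchur.
Variables (n q s t : nat) (K : 'M[C]_(n, q)).
Variables (U1 : 'M[C]_(q, s)) (U2 : 'M[C]_(n, s)).
Variables (V1 : 'M[C]_(t, q)) (V2 : 'M[C]_(t, n)).
Let H := block_mx (- 1%:M) K^h K (- 1%:M : 'M[C]_n).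

Lemma mxrank_bordered_schur :
  \rank (bordered H (col_mx U1 U2) (row_mx V1 V2)) =
  (q + \rank (block_mx (K *m K^h - 1%:M)%R (K *m U1 + U2)%R (V1 *m K^h + V2)%R
                      (V1 *m U1)))%N.
Proof.
have := mxrank_schur (col_mx K V1) (row_mx K^h U1) (block_mx (- 1%:M) U2 V2 0).
rewrite block_mxA mxrank_cast mul_col_row add_block_mx add0r => ->.
by rewrite [- _ + _]addrC [U2 + _]addrC [V2 + _]addrC.
Qed.

Lemma inertia_bordered_schur :
  ipos (bordered H (col_mx U1 U2) (col_mx U1 U2)^h) =
    ipos (block_mx (K *m K^h - 1%:M) (K *m U1 + U2) (K *m U1 + U2)^h (U1^h *m U1)) /\
  ineg (bordered H (col_mx U1 U2) (col_mx U1 U2)^h) =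
    (q + ineg (block_mx (K *m K^h - 1%:M)%R (K *m U1 + U2)%R (K *m U1 + U2)%R^h
                   (U1^h *m U1)))%N.
Proof.
have hW : (block_mx (- 1%:M) U2 U2^h (0 : 'M_s))^h = block_mx (- 1%:M : 'M_n) U2 U2^h 0.
  by rewrite ctmx_block ctmxN ctmx1 ctmx0 ctmxK.
have := inertia_schur (col_mx K U1^h) hW.
rewrite ctmx_col ctmxK block_mxA.
set B := block_mx _ _ _ _ => - [Ep En].
have [cp cn] := inertia_cast (esym (addnA q n s)) B.
have EB : bordered H (col_mx U1 U2) (col_mx U1 U2)^h = B.
  by rewrite /bordered ctmx_col.
have EW : block_mx (- 1%:M) U2 U2^h 0 + col_mx K U1^h *m row_mx K^h U1 =
    block_mx (K *m K^h - 1%:M) (K *m U1 + U2) (K *m U1 + U2)^h (U1^h *m U1).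
  rewrite mul_col_row add_block_mx add0r ctmxD ctmxM.
  by rewrite [- _ + _]addrC [U2 + _]addrC [U2^h + _]addrC.
by rewrite EB -EW -Ep -En cp cn.
Qed.

End BorderedSchur.

Lemma mxrank_col_rowA k1 k2 n1 n2 n3 (A1 : 'M[C]_(k1, n1)) (A2 : 'M[C]_(k1, n2))
    (A3 : 'M[C]_(k1, n3)) (B1 : 'M[C]_(k2, n1)) (B2 : 'M[C]_(k2, n2)) (B3 : 'M[C]_(k2, n3)) :
  \rank (block_mx A1 (row_mx A2 A3) B1 (row_mx B2 B3)) =
  \rank (col_mx (row_mx (row_mx A1 A2) A3) (row_mx (row_mx B1 B2) B3)).
Proof.
rewrite /block_mx !row_mxA; move: (row_mx _ A3) (row_mx _ B3) => X Y.
by case: _ / (esym _) => /=; rewrite !castmx_id.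
Qed.

End Linearization.

(** For the minimal rank, the sum of the two lower bounds is a sum of two binary maxima, expanded
    here into the maximum of four terms; it is attained because the third clause of [extremal] has a
    common minimizer. *)
Lemma extremal_max_min (X : Type) (lp ln rk : X -> nat) (r0 r2 r4 ap an bp bn a b : nat) :
  extremal lp ln r0 r2 r4 ap an bp bn ->
  (forall x, rk x = (lp x + ln x)%N) -> a = (ap + an)%N -> b = (bp + bn)%N ->
  [/\ is_max_of (fun x => (rk x)%:Z) (Num.min r0%:Z (Num.min a%:Z b%:Z)),
      is_min_of (fun x => (rk x)%:Z)
        (2 * r0%:Z + Num.max (Num.max (a%:Z - 2 * r2%:Z) (b%:Z - 2 * r4%:Z))
          (Num.max (ap%:Z + bn%:Z - r2%:Z - r4%:Z) (an%:Z + bp%:Z - r2%:Z - r4%:Z))),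
      is_max_of (fun x => (lp x)%:Z) (Num.min ap%:Z bp%:Z),
      is_max_of (fun x => (ln x)%:Z) (Num.min an%:Z bn%:Z)
    & is_min_of (fun x => (lp x)%:Z)
        (r0%:Z + Num.max (ap%:Z - r2%:Z) (bp%:Z - r4%:Z)) /\
      is_min_of (fun x => (ln x)%:Z)
        (r0%:Z + Num.max (an%:Z - r2%:Z) (bn%:Z - r4%:Z))].
Proof.
move=> [up lo [x1 H1] [[x2 H2] [x3 H3]] [x4 H4]] Erk -> ->.
split; [| | | |split]; split.
- by exists x4; rewrite Erk; have [] := up x4; lia.
- by move=> x; rewrite Erk; have [] := up x; lia.
- by exists x1; rewrite Erk; have [] := lo x1; lia.
- by move=> x; rewrite Erk; have [] := lo x; lia.
- by exists x2; have [] := up x2; lia.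
- by move=> x; have [] := up x; lia.
- by exists x3; have [] := up x3; lia.
- by move=> x; have [] := up x; lia.
- by exists x1; have [] := lo x1; lia.
- by move=> x; have [] := lo x; lia.
- by exists x1; have [] := lo x1; lia.
- by move=> x; have [] := lo x; lia.
Qed.

Theorem theorem4p3 (C : numClosedFieldType) (n p m q : nat)
  (A : 'M[C]_(n, p)) (B : 'M[C]_(m, q)) (Cm : 'M[C]_(n, q)) :
  let phi := fun X : 'M[C]_(p, m) =>
    (A *m X *m B + Cm) *m ctmx (A *m X *m B + Cm) - 1%:M in
  let P := Cm *m ctmx Cm - 1%:M in
  let N1 := block_mx P A (ctmx A) (0 : 'M[C]_(p, p)) in
  let N2 := col_mx (row_mx (row_mx P (Cm *m ctmx B)) A)
                   (row_mx (row_mx (ctmx A) (0 : 'M[C]_(p, m))) (0 : 'M[C]_(p, p))) in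
  let N3 := block_mx P (Cm *m ctmx B) (B *m ctmx Cm) (B *m ctmx B) in
  let N4 := col_mx (row_mx (row_mx P (Cm *m ctmx B)) A)
                   (row_mx (row_mx (B *m ctmx Cm) (B *m ctmx B)) (0 : 'M[C]_(m, p))) in
  let r0 : int := (\rank (row_mx (row_mx P (Cm *m ctmx B)) A))%:Z in
  let s1 : int := (\rank N1)%:Z - 2 * (\rank N2)%:Z in
  let s2 : int := (\rank N3)%:Z - 2 * (\rank N4)%:Z in
  let s3 : int := (ipos N1)%:Z + (ineg N3)%:Z - (\rank N2)%:Z - (\rank N4)%:Z in
  let s4 : int := (ineg N1)%:Z + (ipos N3)%:Z - (\rank N2)%:Z - (\rank N4)%:Z in
  [/\ is_max_of (fun X => (\rank (phi X))%:Z)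
        (Num.min r0 (Num.min (\rank N1)%:Z (\rank N3)%:Z)),
      is_min_of (fun X => (\rank (phi X))%:Z)
        (2 * r0 + Num.max (Num.max s1 s2) (Num.max s3 s4)),
      is_max_of (fun X => (ipos (phi X))%:Z)
        (Num.min (ipos N1)%:Z (ipos N3)%:Z),
      is_max_of (fun X => (ineg (phi X))%:Z)
        (Num.min (ineg N1)%:Z (ineg N3)%:Z)
    & (is_min_of (fun X => (ipos (phi X))%:Z)
        (r0 + Num.max ((ipos N1)%:Z - (\rank N2)%:Z) ((ipos N3)%:Z - (\rank N4)%:Z)) /\
       is_min_of (fun X => (ineg (phi X))%:Z)
        (r0 + Num.max ((ineg N1)%:Z - (\rank N2)%:Z) ((ineg N3)%:Z - (\rank N4)%:Z)))].
Proof.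
move=> phi P N1 N2 N3 N4 r0 s1 s2 s3 s4.
pose H : 'M[C]_(q + n) := block_mx (- 1%:M) Cm^h Cm (- 1%:M).
pose E : 'M[C]_(q + n, p) := col_mx 0 A.
pose F : 'M[C]_(q + n, m) := col_mx B^h 0.
have hH : H^h = H by rewrite ctmx_block !ctmxN !ctmx1 ctmxK.
have hP : P^h = P by rewrite ctmxB herm_gram ctmx1.
have hphi X : (phi X)^h = phi X by rewrite ctmxB herm_gram ctmx1.
have hN1 : N1^h = N1 by rewrite ctmx_block hP ctmxK ctmx0.
have EN3 : (B *m Cm^h)^h = Cm *m B^h by rewrite ctmxM ctmxK.
have hN3 : N3^h = N3 by rewrite ctmx_block hP herm_gram EN3 ctmxM ctmxK.
have EFE : row_mx F E = col_mx (row_mx B^h 0) (row_mx 0 A).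
  by rewrite -block_mxEv block_mxEh.
have EE : E^h = row_mx 0 A^h by rewrite ctmx_col ctmx0.
have EF : F^h = row_mx B 0 by rewrite ctmx_col ctmxK ctmx0.
have lin X : ipos (linform H E F X) = ipos (phi X) /\
             ineg (linform H E F X) = (q + ineg (phi X))%N.
  have h1 : (- 1%:M : 'M[C]_n)^h = - 1%:M by rewrite ctmxN ctmx1.
  have -> : linform H E F X =
      block_mx (- 1%:M) (A *m X *m B + Cm)^h (A *m X *m B + Cm) (- 1%:M).
    rewrite /linform EF /E mul_col_mx mul_col_row !mul0mx mulmx0.
    rewrite ctmx_block !ctmx0 !add_block_mx !(addr0, add0r).
    by rewrite [(_ + Cm)^h]ctmxD [_ + Cm]addrC [_ + Cm^h]addrC.
  by have := inertia_schur (A *m X *m B + Cm) h1; rewrite [- _ + _]addrC.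
(* Eliminating the block -I_q turns the border [E] into [N1] and the border [F] into [N3]. *)
have [i1 i2] := inertia_bordered_schur Cm (0 : 'M_(q, p)) A.
have [i3 i4] := inertia_bordered_schur Cm B^h (0 : 'M_(n, m)).
rewrite !mulmx0 !add0r -/P -/H -/E -/N1 in i1 i2.
rewrite !addr0 !ctmxM !ctmxK -/P -/H -/F -/N3 in i3 i4.
have k0 : \rank (row_mx H (row_mx F E)) =
    (q + \rank (row_mx (row_mx P (Cm *m B^h)) A))%N.
  have := mxrank_bordered_schur Cm (row_mx B^h 0) (row_mx 0 A) (0 : 'M_(0, q)) (0 : 'M_(0, n)).
  rewrite -EFE -/H row_mx0 /bordered /block_mx !mul0mx add0r !row_mx0 !rank_col_mx0 => ->.
  rewrite mul_mx_row mulmx0 add_row_mx addr0 add0r -/P.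
  by rewrite row_mxA mxrank_cast.
have k2 : \rank (bordered H (row_mx F E) E^h) = (q + \rank N2)%N.
  rewrite EFE EE mxrank_bordered_schur -/P mul_mx_row mulmx0 add_row_mx addr0 add0r.
  by rewrite !mul0mx add0r -row_mx0 mxrank_col_rowA.
have k4 : \rank (bordered H (row_mx F E) F^h) = (q + \rank N4)%N.
  rewrite EFE EF mxrank_bordered_schur -/P !mul_mx_row !mulmx0 add_row_mx !addr0 add0r.
  by rewrite mxrank_col_rowA.
have /(extremal_shift (kp := 0) (fun X => proj1 (lin X)) (fun X => proj2 (lin X))
  k0 k2 k4 i1 i2 i3 i4) ext := linform_extremal E F hH.
by apply: (extremal_max_min ext) => [X||]; exact: mxrank_herm.
Qed.
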